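(* There exists $n_0\in\mathbb{N}$ such that for all integers $n\geq n_0$ we have $$\mathrm{sat}(K_4,K_4[n])=18n-21.$$
   Context: $K_4[n]$ denotes the complete $4$-partite graph with parts $X_1,X_2,X_3,X_4$, each an independent set of size $n$ (all edges between distinct parts are present). A spanning subgraph $G$ of $K_4[n]$ (same vertex set) is $(K_4,K_4[n])$-saturated if $G$ contains no copy of $K_4$, but for every edge $uv$ of $K_4[n]$ that is not an edge of $G$, the graph $G\cup uv$ contains a copy of $K_4$. $\mathrm{sat}(K_4,K_4[n])$ is the minimum number of edges $e(G)$ over all $(K_4,K_4[n])$-saturated graphs $G$. *)

(* Defs.v *)
From mathcomp Require Import all_boot.

Set Implicit Arguments.
Unset Strict Implicit.
Unset Printing Implicit Defensive.

(* A simple graph on a finite vertex type V is given by its edge set, a set of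
   two-element subsets of V; all graphs here are spanning, so "G is a subgraph
   of H" is inclusion of edge sets and e(G) is #|G|. *)

Definition contains_K4 (V : finType) (G : {set {set V}}) : bool :=
  [exists K : {set V}, (#|K| == 4) &&
    [forall x in K, forall y in K, (x != y) ==> ([set x; y] \in G)]].

Definition K4_saturated (V : finType) (H G : {set {set V}}) : bool :=
  [&& G \subset H, ~~ contains_K4 G &
      [forall e in H :\: G, contains_K4 (e |: G)]].

Lemma ex_K4_saturated (V : finType) (H : {set {set V}}) :
  exists k : nat, [exists G, K4_saturated H G && (#|G| == k)].
Proof.
pose P := [pred G : {set {set V}} | (G \subset H) && ~~ contains_K4 G].
have P0 : P set0.
  rewrite /= sub0set; apply/existsP => -[K /andP [/eqP cK /forall_inP allK]].
  have [x [y [xK yK xy]]] : exists x y, [/\ x \in K, y \in K & x != y].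
    by apply/card_gt1P; rewrite cK.
  have /forall_inP /(_ y yK) := allK x xK.
  by rewrite xy inE.
have [G /maxsetP [/andP [GH nG] maxG] _] := maxset_exists P0.
exists #|G|; apply/existsP; exists G; rewrite eqxx andbT.
rewrite /K4_saturated GH nG /=; apply/forall_inP => e.
rewrite inE => /andP [eG eH]; case: (boolP (contains_K4 (e |: G))) => // neG.
have PeG : P (e |: G).
  by apply/andP; split; rewrite // subUset sub1set eH GH.
by move: eG; rewrite -(maxG _ PeG (subsetUr _ _)) setU11.
Qed.

Definition sat_K4 (V : finType) (H : {set {set V}}) : nat :=
  ex_minn (ex_K4_saturated H).

(* The part X_i of K_4[n] is the set of vertices with first component i. *)
Definition K4_blowup (n : nat) : {set {set 'I_4 * 'I_n}} :=
  [set e | [exists u : 'I_4 * 'I_n, exists v : 'I_4 * 'I_n,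
     (u.1 != v.1) && (e == [set u; v])]].

(* Main.v *)
Require Import Defs.
From mathcomp Require Import all_boot.
From mathcomp Require Import zify.

Set Implicit Arguments.
Unset Strict Implicit.
Unset Printing Implicit Defensive.

(** A quad is a choice of four pairwise nonadjacent vertices t1, t2, t3, t4, one
    in each part.  Saturation gives two nonadjacent vertices of different parts
    an edge inside their common neighbourhood, which joins the two other parts;
    so the six pairs of a quad have six shared edges.  Three of them have an end
    in a given part X_k, and each of these ends is a common neighbour of one of the
    three pairs of quad vertices outside X_k.  If the three ends coincide, the
    quad has at least 3 edges to X_k; otherwise it has at least 5.  Neighbourhoods contain no
    triangle, so the ends cannot coincide in three of the parts, and this is
    what bounds the degrees from below.

    Lower bound.  Let G have at most 18 n edges, with n large.
    - The vertices of bounded degree are independent once a bounded number of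
      them is removed ([low_independent]): the neighbourhoods of the ends of
      a long induced matching among them would violate a bound for
      cross-intersecting families.  The degrees over an independent set add up
      to at most |G|, so some quad has degree sum at most 18
      ([exists_light_quad]).
    - For such a quad the choice of the shared edges is so tight that it forces
      one configuration ([quad_base]): a core of vertices x and y in two parts
      and z, z' and w, w' in the two others, to which every other vertex of the
      graph is joined in a prescribed way ([base]).
    - Given a core, the edges can be oriented so that the out-degree is at least
      5 in the parts of x and y and at least 4 in the two others, up to a total
      deficit of 21 ([base_edges]).  An orientation counts each edge once, hence
      18 n <= |G| + 21.

    Upper bound.  [model_graph] has two special vertices in each part, joined by
    15 edges; the remaining n - 2 vertices of a part all have the same
    neighbourhood, made of 5, 5, 4 or 4 special vertices.  That is
    15 + 18 (n - 2) = 18 n - 21 edges. *)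

(** * Elements forced by cardinalities *)

Lemma card_ge_size (T : finType) (A : {set T}) (s : seq T) :
  uniq s -> all (mem A) s -> size s <= #|A|.
Proof.
move=> us /allP sA; rewrite -(card_uniqP us).
by apply/subset_leq_card/subsetP => u /sA.
Qed.

Lemma mem_of_card_le (T : finType) (A : {set T}) (s : seq T) (v : T) :
  uniq s -> all (mem A) s -> #|A| <= size s -> v \in A -> v \in s.
Proof.
move=> us sA le vA; apply: contraLR le => vs; rewrite -ltnNge.
by apply: (@card_ge_size _ _ (v :: s)); rewrite /= ?vs ?vA.
Qed.

Lemma card_cons (T : finType) (A : {set T}) (a : T) (s : seq T) :
  uniq (a :: s) -> all (mem A) s -> size s + (a \in A) <= #|A|.
Proof.
rewrite cons_uniq => /andP[nas us] sA; case: (boolP (a \in A)) => aA.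
  by rewrite addn1; apply: (@card_ge_size _ _ (a :: s)); rewrite /= ?aA ?nas.
by rewrite addn0; apply: card_ge_size.
Qed.

Lemma two_mem_card (T : finType) (A : {set T}) a b :
  a != b -> a \in A -> b \in A -> 2 <= #|A|.
Proof.
by move=> ab aA bA; apply: (@card_ge_size _ _ [:: a; b]); rewrite /= ?aA ?bA // inE ab.
Qed.

Lemma mem_card_le1 (T : finType) (A : {set T}) a v : a \in A -> #|A| <= 1 -> v \in A -> v = a.
Proof.
move=> aA le vA; apply/eqP; apply: contraTT le => va; rewrite -ltnNge.
exact: two_mem_card va vA aA.
Qed.

Lemma mem_card_le2 (T : finType) (A : {set T}) a b v : a != b -> a \in A -> b \in A ->
  #|A| <= 2 -> v \in A -> v \in [:: a; b].
Proof.
by move=> ab aA bA le; apply: mem_of_card_le; rewrite /= ?aA ?bA // inE ab.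
Qed.

Lemma mem_card_le2_if (T : finType) (A : {set T}) a b v : a != b -> a \in A ->
  #|A| <= 1 + (b \in A) -> v \in A -> v \in [:: a; b].
Proof.
move=> ab aA; case: (boolP (b \in A)) => bA le vA; first exact: mem_card_le2 le vA.
by rewrite (mem_card_le1 aA le vA) inE eqxx.
Qed.

Lemma eq_mem_card_le2 (T : finType) (A : {set T}) a v1 v2 : a \in A -> #|A| <= 2 ->
  v1 \in A -> v1 != a -> v2 \in A -> v2 != a -> v1 = v2.
Proof.
move=> aA le v1A v1a v2A v2a; rewrite eq_sym in v1a.
by have := mem_card_le2 v1a aA v1A le v2A; rewrite !inE (negbTE v2a) => /eqP.
Qed.

(** For the three ends of shared edges in one part, A, B, C being the sets of
    neighbours there: two distinct ends already cost five incidences. *)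
Lemma common_end (T : finType) (A B C : {set T}) a b c :
    [/\ a \in A & a \in B] -> [/\ b \in B & b \in C] -> [/\ c \in A & c \in C] ->
  #|A| + #|B| + #|C| <= 4 -> a = b /\ a = c.
Proof.
move=> [aA aB] [bB bC] [cA cC].
have A1 := @card_cons _ A a [:: c]; have B1 := @card_cons _ B a [:: b].
have C1 := @card_cons _ C b [:: c].
have A2 := @card_cons _ A a [::]; have B2 := @card_cons _ B a [::]; have C2 := @card_cons _ C b [::].
rewrite /= ?inE ?aA ?aB ?bB ?bC ?cA ?cC ?andbT /= in A1 B1 C1 A2 B2 C2.
have {A2 B2 C2} [A2 B2 C2] := And3 (A2 isT isT) (B2 isT isT) (C2 isT isT).
case: (eqVneq a b) A1 B1 C1 => [<-|ab]; case: (eqVneq a c) => [<- //|ac] A1 B1 C1.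
- by have := A1 isT isT; have := C1 isT isT; lia.
- by have := B1 isT isT; rewrite eq_sym ab in C1; have := C1 isT isT; lia.
have := A1 isT isT; have := B1 isT isT.
case: (eqVneq b c) C1 => [_ _|_ /(_ isT isT)]; last by lia.
lia.
Qed.

Lemma card_bigcup_le (I T : finType) (P : pred I) (F : I -> {set T}) :
  #|\bigcup_(i | P i) F i| <= \sum_(i | P i) #|F i|.
Proof.
elim/big_rec2: _ => [|i s A _ le]; first by rewrite cards0.
by rewrite cardsU (leq_trans (leq_subr _ _)) // leq_add2l.
Qed.

(** * Saturation as a property of the adjacency relation *)

(** Solves a uniqueness goal on an explicit list from disequalities in the
    context, in either direction. *)
Ltac split_uniq :=
  rewrite /= ?inE ?negb_or; repeat (apply/andP; split);
  first [done | assumption | rewrite eq_sym; assumption].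

Definition adj (V : finType) (G : {set {set V}}) : rel V :=
  fun u v => [set u; v] \in G.

Lemma adjC (V : finType) (G : {set {set V}}) u v : adj G u v = adj G v u.
Proof. by rewrite /adj setUC. Qed.

Definition nbh (V : finType) (G : {set {set V}}) (u : V) : {set V} :=
  [set v | adj G u v].

Ltac by_adj := first [assumption | rewrite adjC; assumption].

(** The new K4 created by an edge uv consists of u, v and an edge of their
    common neighbourhood.  The parts k and l of the ends of that edge are chosen
    by the user of [sat_fill], so that symmetric cases need no case analysis. *)
Record saturated (V : finType) (part : V -> 'I_4) (G : {set {set V}}) : Prop :=
  Saturated {
    sat_part : forall u v, adj G u v -> part u != part v;
    sat_free : forall a b c d, adj G a b -> adj G a c -> adj G a d ->
      adj G b c -> adj G b d -> adj G c d -> False;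
    sat_fill : forall u v k l, uniq [:: part u; part v; k; l] -> ~~ adj G u v ->
      exists c d, [/\ part c = k, part d = l, adj G u c, adj G u d &
                   [/\ adj G v c, adj G v d & adj G c d]] }.

(** Closes a goal by exhibiting a K4 whose six edges are in the context. *)
Ltac K4 a b c d := exfalso;
  match goal with satG : saturated _ _ |- _ => apply: (@sat_free _ _ _ satG a b c d) end;
  by_adj.

Lemma mem_four_parts (s : seq 'I_4) i : uniq s -> size s = 4 -> i \in s.
Proof.
move=> us s4; have sub : {subset s <= enum 'I_4} by move=> j _; rewrite mem_enum.
by rewrite (uniq_min_size us sub) ?s4 ?size_enum_ord ?mem_enum.
Qed.

Lemma two_other_parts (i j : 'I_4) : i != j -> exists k l, uniq [:: i; j; k; l].
Proof.
move=> ij; have : 1 < #|~: [set i; j]| by have := cardsC [set i; j]; rewrite cards2 ij card_ord; lia.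
move=> /card_gt1P[k [l [ka la kl]]]; exists k, l; move: ka la; rewrite !inE !negb_or.
by move=> /andP[? ?] /andP[? ?]; split_uniq.
Qed.

(** The common edge of two vertices is automatically spread over the two other
    parts, because adjacent vertices lie in different parts. *)
Lemma saturated_intro (V : finType) (part : V -> 'I_4) (G : {set {set V}}) :
    (forall u v, adj G u v -> part u != part v) ->
    (forall a b c d, adj G a b -> adj G a c -> adj G a d ->
      adj G b c -> adj G b d -> adj G c d -> False) ->
    (forall u v, part u != part v -> ~~ adj G u v -> exists c d,
      [/\ adj G u c, adj G u d, adj G v c, adj G v d & adj G c d]) ->
  saturated part G.
Proof.
move=> sp sf fill; split=> // u v k l up nuv.
have uv : part u != part v by move: up; rewrite /= !inE negb_or => /andP[/andP[]].
have [c [d [uc ud vc vd cd]]] := fill u v uv nuv.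
have part_kl a : adj G u a -> adj G v a -> part a = k \/ part a = l.
  move=> /sp ua /sp va; have := mem_four_parts (part a) up erefl; rewrite !inE.
  by rewrite eq_sym (negbTE ua) eq_sym (negbTE va) /= => /orP[]/eqP; [left|right].
have := sp _ _ cd; have := part_kl c uc vc; have := part_kl d ud vd.
move=> [] ed [] ec; rewrite ed ec ?eqxx // => _; last by exists c, d.
by exists d, c; do !split=> //; rewrite adjC.
Qed.

Lemma contains_K4P (V : finType) (G : {set {set V}}) :
  reflect (exists a b c d, uniq [:: a; b; c; d] /\
    [/\ [/\ adj G a b, adj G a c & adj G a d], adj G b c, adj G b d & adj G c d])
    (contains_K4 G).
Proof.
apply: (iffP existsP) => [[K /andP[/eqP K4 /forall_inP allK]]|].
  have := enum_uniq (mem K); have := mem_enum (mem K); rewrite cardE in K4.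
  case: (enum K) K4 => [|a [|b [|c [|d [|? ?]]]]] // _ Kin up.
  have KG u v : u \in [:: a; b; c; d] -> v \in [:: a; b; c; d] -> u != v -> adj G u v.
    rewrite !Kin => uK vK uv.
    by have /forall_inP/(_ v vK)/implyP/(_ uv) := allK u uK.
  exists a, b, c, d; split=> //; move: up; rewrite /= !inE !negb_or.
  move=> /and4P[/and3P[? ? ?] /andP[? ?] ? _].
  by split; try split; apply: KG; rewrite // !inE eqxx ?orbT.
move=> [a [b [c [d [up [[ab ac ad] bc bd cd]]]]]].
exists [set u in [:: a; b; c; d]]; apply/andP; split.
  by rewrite cardsE (card_uniqP up).
apply/forall_inP => u uK; apply/forall_inP => v vK; apply/implyP.
move: uK vK; rewrite !inE => /or4P[]/eqP -> /or4P[]/eqP ->; rewrite ?eqxx // => _.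
all: by first [assumption | rewrite setUC; assumption].
Qed.

Lemma adj_setU1 (V : finType) (G : {set {set V}}) u v a b : a != b ->
  adj ([set u; v] |: G) a b = (adj G a b) || ((a \in [:: u; v]) && (b \in [:: u; v])).
Proof.
move=> ab; rewrite /adj !inE orbC; congr (_ || _).
apply/eqP/andP => [/setP E|[]].
  by have := E a; have := E b; rewrite !inE !eqxx orbT /= => <- <-.
move=> /orP[]/eqP ea /orP[]/eqP eb; move: ab; rewrite ea eb ?eqxx // => _.
exact: setUC.
Qed.

Lemma K4_blowup_pair n (u v : 'I_4 * 'I_n) :
  ([set u; v] \in K4_blowup n) = (u.1 != v.1).
Proof.
rewrite inE; apply/existsP/idP => [[u' /existsP[v' /andP[uv' /eqP E]]]|uv]; last first.
  by exists u; apply/existsP; exists v; rewrite uv eqxx.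
move/setP: E => E; have := E u; have := E v; have := E u'; have := E v'.
rewrite !inE !eqxx !orbT /= => /orP[]/eqP e1 /orP[]/eqP e2; subst u' v' => //.
- by rewrite eqxx in uv'.
- by move=> _ _; rewrite eq_sym.
- by rewrite eqxx in uv'.
Qed.

Lemma K4_saturatedP n (G : {set {set 'I_4 * 'I_n}}) :
  K4_saturated (K4_blowup n) G <-> G \subset K4_blowup n /\ saturated fst G.
Proof.
have neq_part (u v : 'I_4 * 'I_n) : u.1 != v.1 -> u != v by apply: contra => /eqP ->.
split=> [/and3P[GH noK4 /forall_inP fill]|[GH satG]].
  have sp u v : adj G u v -> u.1 != v.1.
    by move=> uv; rewrite -K4_blowup_pair; apply: (subsetP GH).
  have sf a b c d : adj G a b -> adj G a c -> adj G a d ->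
      adj G b c -> adj G b d -> adj G c d -> False.
    move=> ab ac ad bc bd cd; move/negP: noK4; apply; apply/contains_K4P.
    exists a, b, c, d; split; last by [].
    rewrite /= !inE !negb_or !neq_part //; exact: sp.
  split=> //; apply: saturated_intro => // u v uv nuv.
  have /fill/existsP[K /andP[/eqP K4 /forall_inP allK]] : [set u; v] \in K4_blowup n :\: G.
    by rewrite in_setD K4_blowup_pair uv andbT.
  have KG a b : a \in K -> b \in K -> a != b ->
      adj G a b || ((a \in [:: u; v]) && (b \in [:: u; v])).
    move=> aK bK ab; rewrite -adj_setU1 //.
    by have /forall_inP/(_ b bK)/implyP/(_ ab) := allK a aK.
  have [/andP[uK vK]|nuvK] := boolP ((u \in K) && (v \in K)); last first.
    case/negP: noK4; apply/existsP; exists K; rewrite K4 eqxx.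
    apply/forall_inP => a aK; apply/forall_inP => b bK; apply/implyP => ab.
    case/orP: (KG a b aK bK ab) => // /andP[]; rewrite !inE => /orP[]/eqP ea /orP[]/eqP eb; subst.
    + by rewrite eqxx in ab.
    + by rewrite aK bK in nuvK.
    + by rewrite aK bK in nuvK.
    + by rewrite eqxx in ab.
  have vu : v != u by rewrite eq_sym neq_part.
  have /cards2P[c [d [cd Ecd]]] : #|K :\ u :\ v| == 2.
    have := cardsD1 u K; have := cardsD1 v (K :\ u); rewrite !inE uK vK vu K4 /=.
    by move=> -> /eqP; rewrite !add1n !eqSS => /eqP <-.
  have inK a : a \in [set c; d] -> [/\ a != u, a != v & a \in K].
    by rewrite -Ecd !inE => /and3P[].
  have adjK a b : a \in K -> b \in [set c; d] -> a != b -> adj G a b.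
    move=> aK /inK[bu bv bK] ab; case/orP: (KG a b aK bK ab) => // /andP[_].
    by rewrite !inE (negbTE bu) (negbTE bv).
  have cc : c \in [set c; d] by rewrite !inE eqxx.
  have dd : d \in [set c; d] by rewrite !inE eqxx orbT.
  have [cu cv cK] := inK c cc; have [du dv dK] := inK d dd.
  have [uc ud] : adj G u c /\ adj G u d by split; apply: adjK; rewrite // eq_sym.
  have [vc vd] : adj G v c /\ adj G v d by split; apply: adjK; rewrite // eq_sym.
  have acd : adj G c d by apply: adjK.
  by exists c, d.
apply/and3P; split=> //.
  apply/negP => /contains_K4P[a [b [c [d [_ [[ab ac ad] bc bd cd]]]]]].
  exact: (sat_free satG ab ac ad bc bd cd).
apply/forall_inP => f; rewrite in_setD => /andP[fG]; rewrite inE => /existsP[u /existsP[v]].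
move=> /andP[uv /eqP ef]; subst f.
have [k [l up]] := two_other_parts uv.
have [c [d [pc pd uc ud [vc vd cd]]]] := sat_fill satG up fG.
apply/contains_K4P; exists u, v, c, d.
have gp := sat_part satG.
have us : uniq [:: u; v; c; d].
  by rewrite /= !inE !negb_or !neq_part //; exact: gp.
split=> //; have := us; rewrite /= !inE !negb_or => /and4P[/and3P[? ? ?] /andP[? ?] ? _].
by split; [split| | |]; rewrite adj_setU1 //; apply/orP;
  first [by left | by right; rewrite !inE !eqxx orbT].
Qed.

(** All edge counts below are sums of out-degrees for an asymmetric relation
    inside the adjacency relation: such a relation picks each edge at most
    once. *)
Lemma sum_outdeg_le (V : finType) (G : {set {set V}}) (R : rel V) :
    (forall u v, R u v -> adj G u v) -> (forall u v, R u v -> ~~ R v u) ->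
  \sum_u #|[set v | R u v]| <= #|G|.
Proof.
move=> RG Rasym.
have Rirr u : R u u = false by apply/negP => h; have := Rasym _ _ h; rewrite h.
pose P := [set p : V * V | R p.1 p.2].
have -> : \sum_u #|[set v | R u v]| = #|P|.
  rewrite -sum1_card (eq_bigl (fun p => true && R p.1 p.2)); last first.
    by move=> p; rewrite inE.
  rewrite -(pair_big_dep xpredT R (fun _ _ => 1)) /=.
  by apply: eq_bigr => u _; rewrite -sum1_card; apply: eq_bigl => v; rewrite inE.
have inj : {in P &, injective (fun p : V * V => [set p.1; p.2])}.
  move=> [u v] [u' v']; rewrite !inE /= => Ruv Ruv' /setP E.
  have uv : u != v by apply/eqP => h; move: Ruv; rewrite h Rirr.
  have uv' : u' != v' by apply/eqP => h; move: Ruv'; rewrite h Rirr.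
  have:= E u'; have := E v'; have := E u; have := E v; rewrite !inE !eqxx !orbT.
  move=> /esym/orP[]/eqP ev /esym/orP[]/eqP eu; subst => //; try by rewrite eqxx in uv.
  by move: (Rasym _ _ Ruv); rewrite Ruv'.
rewrite -(card_in_imset inj); apply: subset_leq_card.
by apply/subsetP => f /imsetP[[u v]]; rewrite inE /= => /RG h ->.
Qed.

Lemma sum_degrees_le (V : finType) (part : V -> 'I_4) (G : {set {set V}}) :
  saturated part G -> \sum_u #|nbh G u| <= 2 * #|G|.
Proof.
move=> satG; pose R (s : rel nat) u v := adj G u v && s (part u) (part v).
have half (s : rel nat) : (forall a b, s a b -> ~~ s b a) -> \sum_u #|[set v | R s u v]| <= #|G|.
  move=> sas; apply: sum_outdeg_le => u v /andP[] // uv h.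
  by rewrite /R negb_and (sas _ _ h) orbT.
apply: (@leq_trans (\sum_u (#|[set v | R ltn u v]| + #|[set v | R gtn u v]|))).
  apply: leq_sum => u _; apply: leq_trans (leq_card_setU _ _).
  apply/subset_leq_card/subsetP => v; rewrite !inE /R => uv; rewrite uv /=.
  by have := sat_part satG uv; rewrite neq_ltn.
by rewrite big_split mul2n -addnn leq_add // half // => a b /=; rewrite -leqNgt => /ltnW.
Qed.

(** * Counting edges around a core *)

(** The core of a saturated graph of few edges.  Its edges are the 4-cycle
    x z w y and the pendant edges x w' and y z'; z' and w' may or may not be
    adjacent.  Every other vertex has four edges that can be charged to it: they
    go to the core, except that a vertex in the part of z may have a neighbour in
    the part of x instead of w', and symmetrically for w and y.  In the parts of
    x and y the fourth edge has two possible ends, and a fifth edge will be found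
    outside the core.  Exchanging x with y, z with w and z' with w' is a
    symmetry. *)
Record base (V : finType) (part : V -> 'I_4) (G : {set {set V}})
    (x y z z' w w' : V) : Prop := Base {
  base_parts : uniq [:: part x; part y; part z; part w];
  base_z' : part z' = part z; base_w' : part w' = part w;
  base_zz' : z != z'; base_ww' : w != w';
  base_xy : adj G x y; base_xz : adj G x z; base_xw' : adj G x w';
  base_yz' : adj G y z'; base_yw : adj G y w; base_zw : adj G z w;
  base_nxz' : ~~ adj G x z'; base_nxw : ~~ adj G x w;
  base_nyz : ~~ adj G y z; base_nyw' : ~~ adj G y w';
  base_X : forall v, part v = part x -> v != x ->
    [/\ adj G v y, adj G v w, adj G v z' & adj G v z || adj G v w'];
  base_Y : forall v, part v = part y -> v != y ->
    [/\ adj G v x, adj G v z, adj G v w' & adj G v w || adj G v z'];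
  base_Z : forall v, part v = part z -> v != z -> v != z' ->
    [/\ adj G v x, adj G v y, adj G v w &
        adj G v w' \/ exists a, [/\ part a = part x, a != x & adj G v a]];
  base_W : forall v, part v = part w -> v != w -> v != w' ->
    [/\ adj G v x, adj G v y, adj G v z &
        adj G v z' \/ exists b, [/\ part b = part y, b != y & adj G v b]];
  base_X1 : ~~ adj G z' w' -> forall v1 v2, part v1 = part x -> v1 != x ->
    part v2 = part x -> v2 != x -> ~~ adj G v1 z -> ~~ adj G v2 z -> v1 = v2;
  base_Y1 : ~~ adj G z' w' -> forall v1 v2, part v1 = part y -> v1 != y ->
    part v2 = part y -> v2 != y -> ~~ adj G v1 w -> ~~ adj G v2 w -> v1 = v2 }.

Section Base.
Variables (V : finType) (part : V -> 'I_4) (G : {set {set V}}).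

Lemma base_swap x y z z' w w' :
  base part G x y z z' w w' -> base part G y x w w' z z'.
Proof.
move=> B; have := base_parts B.
rewrite /= !inE !negb_or => /and4P[/and3P[p1 p2 p3] /andP[p4 p5] p6 _].
have q1 := base_xy B; have q2 := base_xz B; have q3 := base_xw' B.
have q4 := base_yz' B; have q5 := base_yw B; have q6 := base_zw B.
split; try by_adj; try (case: B; done); first by split_uniq.
- by move=> v h1 h2 h3; have [? ? ? ?] := base_W B h1 h2 h3; split.
- by move=> v h1 h2 h3; have [? ? ? ?] := base_Z B h1 h2 h3; split.
- by rewrite adjC => /(base_Y1 B).
- by rewrite adjC => /(base_X1 B).
Qed.

Variables (x y z z' w w' : V).
Hypothesis B : base part G x y z z' w w'.
Variable n : nat.
Hypothesis card_part : forall i, #|[set v | part v == i]| = n.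

Let inA a := (part a == part x) && (a != x).
Let inB b := (part b == part y) && (b != y).
Let core := [:: x; y; z; w; z'; w'].

Lemma base_neq : [/\ [/\ part x != part y, part x != part z & part x != part w],
  part y != part z, part y != part w & part z != part w].
Proof.
have := base_parts B.
by rewrite /= !inE !negb_or => /and4P[/and3P[p1 p2 p3] /andP[p4 p5] p6 _].
Qed.

Lemma part_cases v : [\/ part v = part x, part v = part y, part v = part z | part v = part w].
Proof.
have := base_parts B => up.
have : part v \in [:: part x; part y; part z; part w].
  exact: mem_four_parts.
by rewrite !inE => /or4P[]/eqP ->; [constructor 1|constructor 2|constructor 3|constructor 4].
Qed.

Lemma core_uniq : uniq core.
Proof.
have [[p1 p2 p3] p4 p5 p6] := base_neq.
have h u v : part u != part v -> u != v by apply: contra => /eqP ->.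
rewrite /core /= !inE !negb_or (base_zz' B) (base_ww' B) !h ?(base_z' B) ?(base_w' B) //.
by rewrite eq_sym.
Qed.

Let zone v := if v \in core then 0 else
  if part v == part x then 1 else if part v == part y then 2 else
  if part v == part z then 3 else 4.

(** The orientation points from the complement of the core into the core; between
    the parts X, Y, Z, W of x, y, z, w outside the core it goes X -> W, Y -> Z,
    Z -> X and W -> Y, and follows [o] between X and Y.  The targets are
    out-degree 5 in X and Y and 4 in Z and W.  In Z and W they are always met.
    In X and Y four out-edges go to the core, and the hypotheses provide a fifth
    one except for the vertices listed in [ex].  The core has six edges, or seven
    with z'w', against a target of 26. *)
Lemma edge_count (o : rel V) (ex : seq V) :
    (forall a, inA a -> [\/ a \in ex, adj G a z /\ adj G a w',
        exists b, [/\ inB b, adj G a b & o a b] |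
        exists d, [/\ part d = part w, d != w, d != w' & adj G a d]]) ->
    (forall b, inB b -> [\/ b \in ex, adj G b w /\ adj G b z',
        exists a, [/\ inA a, adj G b a & ~~ o a b] |
        exists c, [/\ part c = part z, c != z, c != z' & adj G b c]]) ->
  18 * n + adj G z' w' <= #|G| + 20 + size ex.
Proof.
move=> hA hB.
have [[p1 p2 p3] p4 p5 p6] := base_neq.
pose R u v := adj G u v &&
  match zone u, zone v with
  | 0, 0 => index u core < index v core
  | 0, _ => false | _, 0 => true
  | 1, 2 => o u v | 2, 1 => ~~ o v u
  | 1, 4 | 2, 3 | 3, 1 | 4, 2 => true
  | _, _ => false
  end.
have Radj u v : R u v -> adj G u v by case/andP.
have Rasym u v : R u v -> ~~ R v u.
  rewrite /R => /andP[_]; case: (zone u) => [|[|[|[|[|?]]]]];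
  case: (zone v) => [|[|[|[|[|?]]]]] //=; rewrite ?andbF // => h;
  rewrite negb_and ?h ?orbT // -leqNgt ltnW ?orbT //.
have outdeg u s : uniq s -> all (R u) s -> size s <= #|[set v | R u v]|.
  by move=> us /allP sR; apply: card_ge_size => //; apply/allP => v /sR; rewrite /= inE.
(* The target out-degree and, in L, the deficits that are allowed. *)
pose c u := if (part u == part x) || (part u == part y) then 5 else 4.
pose L := [:: (x, 2); (y, 3); (z, 3); (z', 4 - adj G z' w'); (w, 4); (w', 4)]
          ++ [seq (v, 1) | v <- ex].
have sumL : \sum_u \sum_(p <- L | p.1 == u) p.2 = 20 - adj G z' w' + size ex.
  rewrite (exchange_big_dep xpredT) //=.
  rewrite (eq_bigr (fun p => p.2)); last first.
    by move=> p _; rewrite (big_pred1 p.1).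
  rewrite /L big_cat /= big_map sum1_size !big_cons big_nil /=.
  by case: (adj G z' w').
have sumc : \sum_u c u = 18 * n.
  rewrite (partition_big part xpredT) //=.
  rewrite (eq_bigr (fun i => n * (if (i == part x) || (i == part y) then 5 else 4))); last first.
    move=> i _; rewrite -(card_part i) -sum_nat_const.
    by apply: eq_big => [u|u /eqP <-]; rewrite ?inE.
  rewrite -big_distrr /= mulnC; congr (_ * _).
  have -> : forall F : 'I_4 -> nat, \sum_i F i =
      \sum_(i <- [:: part x; part y; part z; part w]) F i.
    move=> F; rewrite -big_enum /=; apply: perm_big; apply: uniq_perm.
    - exact: enum_uniq.
    - exact: base_parts B.
    - by move=> i; rewrite mem_enum [RHS]mem_four_parts // (base_parts B).
  rewrite !big_cons big_nil !eqxx orbT /=.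
  rewrite (eq_sym (part z)) (eq_sym (part z)) (eq_sym (part w)) (eq_sym (part w)).
  by rewrite (negbTE p2) (negbTE p3) (negbTE p4) (negbTE p5).
have neqs := core_uniq.
move: neqs; rewrite /= !inE !negb_or => /and5P[/and5P[nxy nxz nxw nxz' nxw']].
move=> /and4P[nyz nyw nyz' nyw'] /and3P[nzw nzz' nzw'] /andP[nwz' nww'] /andP[nz'w' _].
have key u : c u <= #|[set v | R u v]| + \sum_(p <- L | p.1 == u) p.2.
  have loss v k : (v, k) \in L -> k <= \sum_(p <- L | p.1 == v) p.2.
    by move=> vk; rewrite (big_rem _ vk) /= eqxx leq_addr.
  have lossL k : (u, k) \in L -> c u <= #|[set v | R u v]| + k ->
      c u <= #|[set v | R u v]| + \sum_(p <- L | p.1 == u) p.2.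
    by move=> /loss h h'; apply: leq_trans h' _; rewrite leq_add2l.
  have enough s : uniq s -> all (R u) s -> c u <= size s ->
      c u <= #|[set v | R u v]| + \sum_(p <- L | p.1 == u) p.2.
    by move=> us sR h; rewrite (leq_trans h) // (leq_trans (outdeg u s us sR)) ?leq_addr.
  have core_zone v : v \in core -> zone v = 0 by rewrite /zone => ->.
  have Rcore v : u \notin core -> v \in core -> adj G u v -> R u v.
    move=> ucore vcore uv; rewrite /R uv (core_zone v) //= /zone (negbTE ucore).
    by do 3 (case: ifP => //).
  have neq a b : a \notin core -> b \in core -> b != a.
    by move=> h h'; apply: contraNneq h => <-.
  have ix i := @index_uniq _ x i core ^~ core_uniq.
  have [ucore|ucore] := boolP (u \in core).
    have Rin v : v \in core -> adj G u v -> index u core < index v core -> R u v.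
      by move=> vcore uv h; rewrite /R uv !core_zone.
    have [i0 i1 i2] := And3 (ix 0 isT) (ix 1 isT) (ix 2 isT).
    have [i3 i4 i5] := And3 (ix 3 isT) (ix 4 isT) (ix 5 isT).
    rewrite /nth -/core in i0 i1 i2 i3 i4 i5.
    have [[m0 m1 m2] m3 m4 m5] : [/\ [/\ x \in core, y \in core & z \in core],
        w \in core, z' \in core & w' \in core] by rewrite !inE !eqxx !orbT.
    have Lmem v : v \in [:: (x, 2); (y, 3); (z, 3); (z', 4 - adj G z' w'); (w, 4); (w', 4)]
        -> v \in L by rewrite /L mem_cat => ->.
    have cx : c x = 5 by rewrite /c eqxx.
    have cy : c y = 5 by rewrite /c eqxx orbT.
    have cz v : part v = part z \/ part v = part w -> c v = 4.
      rewrite /c eq_sym (eq_sym _ (part y)) => -[]->;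
      by rewrite ?(negbTE p2) ?(negbTE p3) ?(negbTE p4) ?(negbTE p5).
    move: (ucore); rewrite !inE => /or4P[||| /or3P[||]] /eqP eu; subst u.
    - apply: (lossL 2); first by apply: Lmem; rewrite !inE eqxx.
      rewrite cx addn2; apply: (outdeg x [:: y; z; w']); first by split_uniq.
      by rewrite /= !Rin // ?i0 ?i1 ?i2 ?i5 ?(base_xy B) ?(base_xz B) ?(base_xw' B).
    - apply: (lossL 3); first by apply: Lmem; rewrite !inE eqxx !orbT.
      rewrite cy addn3; apply: (outdeg y [:: z'; w]); first by split_uniq.
      by rewrite /= !Rin // ?i1 ?i3 ?i4 ?(base_yz' B) ?(base_yw B).
    - apply: (lossL 3); first by apply: Lmem; rewrite !inE eqxx !orbT.
      rewrite cz ?addn3; last by left.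
      by apply: (outdeg z [:: w]) => //=; rewrite !Rin // ?i2 ?i3 ?(base_zw B).
    - apply: (lossL 4); first by apply: Lmem; rewrite !inE eqxx !orbT.
      by rewrite cz ?leq_addl //; right.
    - apply: (lossL (4 - adj G z' w')); first by apply: Lmem; rewrite !inE eqxx !orbT.
      rewrite cz ?(base_z' B) //; last by left.
      case E : (adj G z' w'); last by rewrite leq_addl.
      rewrite addnC; apply: (outdeg z' [:: w']) => //=.
      by rewrite !Rin // ?i4 ?i5.
    - apply: (lossL 4); first by apply: Lmem; rewrite !inE eqxx !orbT.
      by rewrite cz ?leq_addl //; right; apply: (base_w' B).
  have [[m0 m1 m2] m3 m4 m5] : [/\ [/\ x \in core, y \in core & z \in core],
      w \in core, z' \in core & w' \in core] by rewrite !inE !eqxx !orbT.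
  have exL : u \in ex -> (u, 1) \in L.
    by move=> h; rewrite /L mem_cat (map_f (fun v => (v, 1)) h) orbT.
  have neqc a b : a \in core -> b \notin core -> a != b.
    by move=> h; apply: contraNneq => <-.
  have hp a b : part a != part b -> a != b by apply: contra => /eqP ->.
  have ncA a : part a = part x -> a != x -> a \notin core.
    by move=> pa xa; rewrite !inE !negb_or xa !hp // pa ?(base_z' B) ?(base_w' B).
  have ncB a : part a = part y -> a != y -> a \notin core.
    move=> pa xa; rewrite !inE !negb_or xa !hp // pa ?(base_z' B) ?(base_w' B) //.
    by rewrite eq_sym.
  have ncC a : part a = part z -> a != z -> a != z' -> a \notin core.
    move=> pa za za'; rewrite !inE !negb_or za za' !hp // pa ?(base_w' B) //;
    by rewrite eq_sym.
  have ncD a : part a = part w -> a != w -> a != w' -> a \notin core.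
    move=> pa za za'; rewrite !inE !negb_or za za' !hp // pa ?(base_z' B) //;
    by rewrite eq_sym.
  have [zoneA zoneB zoneC] : [/\ forall v, v \notin core -> part v = part x -> zone v = 1,
     forall v, v \notin core -> part v = part y -> zone v = 2
     & forall v, v \notin core -> part v = part z -> zone v = 3].
    split=> v vc pv; rewrite /zone (negbTE vc) pv ?eqxx // eq_sym ?(negbTE p1) ?(negbTE p2) ?eqxx //.
    by rewrite eq_sym (negbTE p4).
  have zoneD v : v \notin core -> part v = part w -> zone v = 4.
    move=> vc pv; rewrite /zone (negbTE vc) pv eq_sym (negbTE p3) eq_sym (negbTE p5).
    by rewrite eq_sym (negbTE p6).
  have c4 v : part v = part z \/ part v = part w -> c v = 4.
    rewrite /c eq_sym (eq_sym _ (part y)) => -[]->;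
    by rewrite ?(negbTE p2) ?(negbTE p3) ?(negbTE p4) ?(negbTE p5).
  have [pu|pu|pu|pu] := part_cases u.
  - have ux : u != x by rewrite eq_sym neqc.
    have cu : zone u = 1 by rewrite /zone (negbTE ucore) pu eqxx.
    have c5 : c u = 5 by rewrite /c pu eqxx.
    have [uy uw uz' uzw'] := base_X B pu ux.
    have [s [sc us su]] : exists s, [/\ s \in core, R u s & uniq [:: y; w; z'; s]].
      case/orP: uzw' => h; [exists z|exists w']; split; rewrite ?Rcore //; split_uniq.
    have five v : v \notin core -> R u v -> c u <= #|[set v | R u v]| + \sum_(p <- L | p.1 == u) p.2.
      move=> vc uv; apply: (enough [:: v; y; w; z'; s]); last by rewrite c5.
        by rewrite cons_uniq su andbT !inE !negb_or !(eq_sym v) !neqc.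
      by rewrite /= uv us !Rcore.
    have := hA u; rewrite /inA pu eqxx ux => -[//|uex|[h1 h2]|[b [/andP[/eqP pb yb] ub oub]]|[d [pd dw dw' ud]]].
    + apply: (lossL 1); first exact: exL.
      rewrite c5 addn1; apply: (outdeg u [:: y; w; z'; s]) => //.
      by rewrite /= us !Rcore.
    + apply: (enough [:: y; w; z'; z; w']); last by rewrite c5.
        by split_uniq.
      by rewrite /= !Rcore.
    + have bc := ncB _ pb yb.
      apply: (five b) => //; by rewrite /R ub cu zoneB.
    + have dc := ncD _ pd dw dw'.
      by apply: (five d) => //; rewrite /R ud cu zoneD.
  - have uy : u != y by rewrite eq_sym neqc.
    have cu := zoneB u ucore pu.
    have c5 : c u = 5 by rewrite /c pu eqxx orbT.
    have [ux uz uw' uwz'] := base_Y B pu uy.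
    have [s [sc us su]] : exists s, [/\ s \in core, R u s & uniq [:: x; z; w'; s]].
      case/orP: uwz' => h; [exists w|exists z']; split; rewrite ?Rcore //; split_uniq.
    have five v : v \notin core -> R u v -> c u <= #|[set v | R u v]| + \sum_(p <- L | p.1 == u) p.2.
      move=> vc uv; apply: (enough [:: v; x; z; w'; s]); last by rewrite c5.
        by rewrite cons_uniq su andbT !inE !negb_or !(eq_sym v) !neqc.
      by rewrite /= uv us !Rcore.
    have := hB u; rewrite /inB pu eqxx uy => -[//|uex|[h1 h2]|[a [/andP[/eqP pa xa] ua oua]]|[d [pd dz dz' ud]]].
    + apply: (lossL 1); first exact: exL.
      rewrite c5 addn1; apply: (outdeg u [:: x; z; w'; s]) => //.
      by rewrite /= us !Rcore.
    + apply: (enough [:: x; z; w'; w; z']); last by rewrite c5.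
        by split_uniq.
      by rewrite /= !Rcore.
    + have ac := ncA _ pa xa.
      by apply: (five a) => //; rewrite /R ua cu zoneA.
    + have dc := ncC _ pd dz dz'.
      by apply: (five d) => //; rewrite /R ud cu zoneC.
  - have cu := zoneC u ucore pu.
    have nu v : v \in core -> u != v by move=> h; rewrite eq_sym neqc.
    have [ux uy uw h] := base_Z B pu (nu _ m2) (nu _ m4).
    have [s [su us]] : exists s, R u s /\ uniq [:: s; x; y; w].
      case: h => [h|[a [pa xa ua]]].
        by exists w'; split; [rewrite Rcore|split_uniq].
      have ac := ncA _ pa xa; exists a; split; first by rewrite /R ua cu zoneA.
      by rewrite cons_uniq !inE !negb_or !(eq_sym a) !neqc //; split_uniq.
    apply: (enough [:: s; x; y; w]) => //; last by rewrite c4 //; left.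
    by rewrite /= su !Rcore.
  - have cu := zoneD u ucore pu.
    have nu v : v \in core -> u != v by move=> h; rewrite eq_sym neqc.
    have [ux uy uz h] := base_W B pu (nu _ m3) (nu _ m5).
    have [s [su us]] : exists s, R u s /\ uniq [:: s; x; y; z].
      case: h => [h|[a [pa xa ua]]].
        by exists z'; split; [rewrite Rcore|split_uniq].
      have ac := ncB _ pa xa; exists a; split; first by rewrite /R ua cu zoneB.
      by rewrite cons_uniq !inE !negb_or !(eq_sym a) !neqc //; split_uniq.
    apply: (enough [:: s; x; y; z]) => //; last by rewrite c4 //; right.
    by rewrite /= su !Rcore.
have := @leq_sum _ (index_enum V) xpredT _ _ (fun u _ => key u).
rewrite big_split /= sumL sumc.
move: (sum_outdeg_le Radj Rasym); clear.
by move: #|G| (\sum_u #|_|) (size ex) => g r e; case: (adj G z' w') => /=; lia.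
Qed.

End Base.

(** * Orienting the edges between the parts of x and y *)

Section BaseCount.
Variables (V : finType) (part : V -> 'I_4) (G : {set {set V}}).
Hypothesis satG : saturated part G.

(** The fifth edge: if a misses w', the edge shared by a and w' has an end in the
    part of y other than y, since y misses w'; if a misses z, likewise with z. *)
Lemma base_X_nbr x y z z' w w' a : base part G x y z z' w w' ->
    part a = part x -> ~~ (adj G a z && adj G a w') ->
  exists b, [/\ part b = part y, b != y & adj G a b].
Proof.
move=> B pa; have [[p1 p2 p3] p4 p5 p6] := base_neq B.
rewrite negb_and => /orP[] na.
  have [|b [d [pb pd ab ad [zb zd bd]]]] := @sat_fill _ _ _ satG a z (part y) (part w) _ na.
    by rewrite pa; split_uniq.
  by exists b; split=> //; apply: contraNneq (base_nyz B) => <-; rewrite adjC.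
have [|b [d [pb pd ab ad [zb zd bd]]]] := @sat_fill _ _ _ satG a w' (part y) (part z) _ na.
  by rewrite pa (base_w' B); split_uniq.
by exists b; split=> //; apply: contraNneq (base_nyw' B) => <-; rewrite adjC.
Qed.

(** A vertex a of the part of x that misses w' and a vertex b of the part of y
    that misses w need an out-edge each, but possibly only the edges between such
    vertices are available.  If a and b are not adjacent, they share an edge whose
    end in the part of w is neither w nor w', so a is paid outside X and Y.
    Hence either every a is paid in that way, and all edges between X and Y can be
    used for the b's; or some a0 is adjacent to all the b's and pays for each of
    them, a0 alone stays unpaid and the other a's keep their edges.  The predicate
    g selects the a's that keep their edges. *)
Lemma base_payment x y z z' w w' : base part G x y z z' w w' ->
  exists (g : pred V) (ex : seq V), [/\ size ex <= 1,
    forall a, part a = part x -> a != x -> ~~ adj G a w' ->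
      [\/ a \in ex, g a | exists d, [/\ part d = part w, d != w, d != w' & adj G a d]] &
    forall b, part b = part y -> b != y -> ~~ adj G b w ->
      exists a, [/\ part a = part x, a != x, adj G b a & g a -> adj G a w']].
Proof.
move=> B; have [[p1 p2 p3] p4 p5 p6] := base_neq B.
pose full a := [&& part a == part x, a != x, ~~ adj G a w' &
  [forall b, [&& part b == part y, b != y & ~~ adj G b w] ==> adj G b a]].
have [[a0 /and4P[/eqP pa0 xa0 wa0 /forallP fa0]]|nofull] := altP (@existsP _ full).
  exists (fun a => a != a0), [:: a0]; split=> //.
    by move=> a *; rewrite inE; case: eqP; [constructor 1|constructor 2].
  move=> b pb yb wb; exists a0; split=> //; last by rewrite eqxx.
  by have := fa0 b; rewrite pb eqxx yb wb.
exists pred0, [::]; split=> //.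
  move=> a pa xa wa; constructor 3.
  have : ~~ full a by apply: contra nofull => h; apply/existsP; exists a.
  rewrite /full pa eqxx xa wa /= => /forallPn[b]; rewrite negb_imply => /andP[].
  move=> /and3P[/eqP pb yb wb] nab.
  have [|c [d [pc pd bc bd [ac ad cd]]]] := @sat_fill _ _ _ satG b a (part z) (part w) _ nab.
    by rewrite pa pb; split_uniq.
  exists d; split=> //; first by apply: contraNneq wb => <-.
  by apply: contraNneq wa => <-.
move=> b pb yb wb.
have [|a [pa xa ab]] := base_X_nbr (base_swap B) pb; first by rewrite negb_and wb.
by exists a; split.
Qed.

Variable n : nat.
Hypothesis card_part : forall i, #|[set v | part v == i]| = n.

(** When z'w' is missing, the core has one edge less, and only one unpaid vertex
    can be afforded.  The vertex a0 is the only one of its part that misses z, and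
    at most one vertex of the part of y misses w.  The edge a0 b0 comes from the
    edge shared by z' and w'; it serves neither the vertices that miss w' nor
    those that miss z', so it can pay for a0. *)
Lemma base_edges_sparse x y z z' w w' a0 b0 : base part G x y z z' w w' ->
    ~~ adj G z' w' -> part a0 = part x -> a0 != x -> ~~ adj G a0 z ->
    part b0 = part y -> b0 != y -> adj G b0 z' -> adj G a0 b0 ->
  18 * n <= #|G| + 21.
Proof.
move=> B nzw pa0 xa0 za0 pb0 yb0 zb0 ab0.
pose B1 b := [&& part b == part y, b != y & ~~ adj G b w].
pose ex := if [pick b | B1 b] is Some b then [:: b] else [::].
have exP b : B1 b -> b \in ex.
  move=> Bb; rewrite /ex; case: pickP => [b' Bb'|/(_ b)]; last by rewrite Bb.
  case/and3P: Bb => /eqP pb yb wb; case/and3P: Bb' => /eqP pb' yb' wb'.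
  by rewrite inE (base_Y1 B nzw pb yb pb' yb' wb wb').
have sz : size ex <= 1 by rewrite /ex; case: pickP.
pose o a b := ~~ adj G a w' || ((a == a0) && (b == b0)).
suff : 18 * n + adj G z' w' <= #|G| + 20 + size ex by lia.
apply: (edge_count B card_part (o := o)).
  move=> a /andP[/eqP pa xa].
  case: (boolP (adj G a z && adj G a w')) => [/andP[]|na]; first by constructor 2.
  case: (boolP (adj G a w')) => wa; last first.
    constructor 3; have [b [pb yb ab]] := base_X_nbr B pa na.
    by exists b; rewrite /o wa pb eqxx yb.
  rewrite wa andbT in na; rewrite (base_X1 B nzw pa xa pa0 xa0 na za0).
  by constructor 3; exists b0; rewrite /o !eqxx pb0 eqxx yb0 orbT.
move=> b /andP[/eqP pb yb].
case: (boolP (adj G b w)) => wb; last by constructor 1; apply: exP; rewrite /B1 pb eqxx yb.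
case: (boolP (adj G b z')) => zb; first by constructor 2.
constructor 3.
have [|a [pa xa ab]] := base_X_nbr (base_swap B) pb; first by rewrite negb_and zb orbT.
exists a; split=> //; first by rewrite pa eqxx.
rewrite negb_or negbK; apply/andP; split; last first.
  by rewrite negb_and orbC; apply/orP; left; apply: contraNneq zb => ->.
have [ay aw az' /orP[az|//]] := base_X B pa xa.
have [bx bz bw' _] := base_Y B pb yb.
by have zw := base_zw B; K4 a b z w.
Qed.

(** If z'w' is an edge, then a vertex of the part of x that misses w' sees z, so
    its neighbours in the part of y miss w; one that misses z sees w', so its
    neighbours in the part of y miss z'.  Hence the two instances of
    [base_payment], for the core and for its mirror image, concern disjoint sets
    of edges, and together they leave at most two vertices unpaid.  Otherwise the
    edge shared by z' and w' leads to [base_edges_sparse]. *)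
Lemma base_edges x y z z' w w' : base part G x y z z' w w' ->
  18 * n <= #|G| + 21.
Proof.
move=> B; have [[p1 p2 p3] p4 p5 p6] := base_neq B.
have zw := base_zw B.
have noA0B0 a b : part a = part x -> a != x -> part b = part y -> b != y ->
    adj G a b -> adj G a z -> ~~ adj G b w.
  move=> pa xa pb yb ab az; apply/negP => bw.
  have [_ aw _ _] := base_X B pa xa; have [_ bz _ _] := base_Y B pb yb.
  K4 a b z w.
have [zw'|nzw] := boolP (adj G z' w').
  have noA1B1 a b : part a = part x -> a != x -> part b = part y -> b != y ->
      adj G a b -> adj G a w' -> ~~ adj G b z'.
    move=> pa xa pb yb ab aw; apply/negP => bz.
    have [_ _ az _] := base_X B pa xa; have [_ _ bw _] := base_Y B pb yb.
    K4 a b z' w'.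
  have [g1 [ex1 [s1 g1A g1B]]] := base_payment B.
  have [g2 [ex2 [s2 g2B g2A]]] := base_payment (base_swap B).
  (* Edges are oriented from a to b where o holds: those of a vertex a that misses w'
     follow g1, those of an a that misses z follow g2, all others pay for b. *)
  pose o a b := if ~~ adj G a w' then g1 a else
    if ~~ adj G a z then (if ~~ adj G b z' then ~~ g2 b else true) else false.
  suff : 18 * n + adj G z' w' <= #|G| + 20 + size (ex1 ++ ex2).
    by rewrite size_cat zw'; lia.
  apply: (edge_count B card_part (o := o)).
    move=> a /andP[/eqP pa xa].
    case: (boolP (adj G a z && adj G a w')) => [/andP[]|na]; first by constructor 2.
    case: (boolP (adj G a w')) => wa; last first.
      case: (g1A a pa xa wa) => [h|h|h]; last by constructor 4.
        by constructor 1; rewrite mem_cat h.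
      constructor 3; have [b [pb yb ab]] := base_X_nbr B pa na.
      by exists b; rewrite /o wa h pb eqxx yb.
    rewrite wa andbT in na; constructor 3.
    have [b [pb yb ab gb]] := g2A a pa xa na.
    exists b; split=> //; first by rewrite pb eqxx.
    rewrite /o wa na /=; case: ifP => // nbz.
    by apply: contraNN nbz => /gb.
  move=> b /andP[/eqP pb yb].
  case: (boolP (adj G b w && adj G b z')) => [/andP[]|nb]; first by constructor 2.
  case: (boolP (adj G b z')) => zb; last first.
    case: (g2B b pb yb zb) => [h|h|h]; last by constructor 4.
      by constructor 1; rewrite mem_cat h orbT.
    constructor 3; have [a [pa xa ab]] := base_X_nbr (base_swap B) pb nb.
    exists a; split=> //; first by rewrite pa eqxx.
    have bw : adj G b w by have [_ _ _ /orP[//|]] := base_Y B pb yb; rewrite (negbTE zb).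
    rewrite adjC in ab; rewrite /o.
    have az : ~~ adj G a z by apply/negP => /(noA0B0 a b pa xa pb yb ab); rewrite bw.
    have [_ _ _ ] := base_X B pa xa; rewrite (negbTE az) /= => ->.
    by rewrite zb h.
  rewrite zb andbT in nb; constructor 3.
  have [a [pa xa ab ga]] := g1B b pb yb nb.
  exists a; split=> //; first by rewrite pa eqxx.
  rewrite adjC in ab; have wa : ~~ adj G a w'.
    by apply/negP => /(noA1B1 a b pa xa pb yb ab); rewrite zb.
  by rewrite /o wa; apply: contraNN wa.
have [|a [b [pa pb za zb [wa wb ab]]]] := @sat_fill _ _ _ satG z' w' (part x) (part y) _ nzw.
  by rewrite (base_z' B) (base_w' B); split_uniq.
have xa : a != x by apply: contraNneq (base_nxz' B) => <-; rewrite adjC.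
have yb : b != y by apply: contraNneq (base_nyw' B) => <-; rewrite adjC.
have [az|az] := boolP (adj G a z).
  have bw := noA0B0 a b pa xa pb yb ab az.
  apply: (base_edges_sparse (base_swap B) (a0 := b) (b0 := a)); rewrite // adjC //.
apply: (base_edges_sparse B (a0 := a) (b0 := b)); rewrite // adjC //.
Qed.
End BaseCount.

(** * From a quad with two hubs to a core *)

Lemma uniq_swap (T : eqType) (a b c d : T) :
  uniq [:: a; b; c; d] -> uniq [:: b; a; d; c].
Proof.
rewrite /= !inE !negb_or => /and4P[/and3P[p1 p2 p3] /andP[p4 p5] p6 _].
by split_uniq.
Qed.

(** A quad of degree sum 18 and its shared edges.  The hubs x and y carry all
    shared edge ends in their parts.  The neighbours of t3 and t4 are exactly the
    ones listed.  Both t1 and t2 may have one more neighbour: t1 sees either w' or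
    one further vertex in the part of y, and t2 sees either z' or one further
    vertex in the part of x. *)
Record hub (V : finType) (part : V -> 'I_4) (G : {set {set V}})
    (t1 t2 t3 t4 x y z z' w w' : V) : Prop := Hub {
  hub_parts : uniq [:: part t1; part t2; part t3; part t4];
  hub_px : part x = part t1; hub_py : part y = part t2;
  hub_pz : part z = part t3; hub_pz' : part z' = part t3;
  hub_pw : part w = part t4; hub_pw' : part w' = part t4;
  hub_zz' : z != z'; hub_ww' : w != w';
  hub_xy : adj G x y; hub_xz : adj G x z; hub_xw' : adj G x w';
  hub_yz' : adj G y z'; hub_yw : adj G y w; hub_zw : adj G z w;
  hub_t1 : [/\ adj G t1 y, adj G t1 z, adj G t1 z' & adj G t1 w];
  hub_t2 : [/\ adj G t2 x, adj G t2 w, adj G t2 w' & adj G t2 z];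
  hub_t3 : [/\ adj G t3 x, adj G t3 y, adj G t3 w & adj G t3 w'];
  hub_t4 : [/\ adj G t4 y, adj G t4 x, adj G t4 z & adj G t4 z'];
  hub_3X : forall v, part v = part t1 -> adj G t3 v -> v = x;
  hub_4X : forall v, part v = part t1 -> adj G t4 v -> v = x;
  hub_3Y : forall v, part v = part t2 -> adj G t3 v -> v = y;
  hub_4Y : forall v, part v = part t2 -> adj G t4 v -> v = y;
  hub_3W : forall v, part v = part t4 -> adj G t3 v -> v \in [:: w; w'];
  hub_4Z : forall v, part v = part t3 -> adj G t4 v -> v \in [:: z; z'];
  hub_1Z : forall v, part v = part t3 -> adj G t1 v -> v \in [:: z; z'];
  hub_1W : forall v, part v = part t4 -> adj G t1 v -> v \in [:: w; w'];
  hub_2Z : forall v, part v = part t3 -> adj G t2 v -> v \in [:: z; z'];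
  hub_2W : forall v, part v = part t4 -> adj G t2 v -> v \in [:: w; w'];
  hub_1Y : forall v1 v2, part v1 = part t2 -> adj G t1 v1 -> v1 != y ->
    part v2 = part t2 -> adj G t1 v2 -> v2 != y -> v1 = v2;
  hub_2X : forall v1 v2, part v1 = part t1 -> adj G t2 v1 -> v1 != x ->
    part v2 = part t1 -> adj G t2 v2 -> v2 != x -> v1 = v2;
  hub_1w' : adj G t1 w' -> forall v, part v = part t2 -> adj G t1 v -> v = y;
  hub_2z' : adj G t2 z' -> forall v, part v = part t1 -> adj G t2 v -> v = x }.

Section Hub.
Variables (V : finType) (part : V -> 'I_4) (G : {set {set V}}).
Hypothesis satG : saturated part G.

Lemma hub_swap t1 t2 t3 t4 x y z z' w w' :
  hub part G t1 t2 t3 t4 x y z z' w w' -> hub part G t2 t1 t4 t3 y x w w' z z'.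
Proof.
move=> H; split; try (by case: H); first exact: uniq_swap (hub_parts H).
all: by rewrite adjC; case: H.
Qed.

(** A vertex v of the part of x other than x is not adjacent to t3 and t4, whose
    neighbourhoods contain only one edge that it can share; this gives three of
    the four edges, and t2 gives the fourth.  If v itself is the additional
    neighbour of t2, then z' and t2 are not adjacent and the edge they share must
    be v w'.  Vertices of the part of z are treated in the same way. *)
Lemma hub_one_side t1 t2 t3 t4 x y z z' w w' :
    hub part G t1 t2 t3 t4 x y z z' w w' ->
  [/\ ~~ adj G x z' /\ ~~ adj G x w, ~~ adj G z w',
    forall v, part v = part x -> v != x ->
      [/\ adj G v y, adj G v w, adj G v z' & adj G v z || adj G v w'],
    forall v, part v = part z -> v != z -> v != z' ->
      [/\ adj G v x, adj G v y, adj G v w &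
        adj G v w' \/ exists a, [/\ part a = part x, a != x & adj G v a]] &
    ~~ adj G z' w' -> forall v1 v2, part v1 = part x -> v1 != x ->
      part v2 = part x -> v2 != x -> ~~ adj G v1 z -> ~~ adj G v2 z -> v1 = v2].
Proof.
move=> H; have := hub_parts H.
rewrite /= !inE !negb_or => /and4P[/and3P[p12 p13 p14] /andP[p23 p24] p34 _].
have [px py pz pz' pw] := And5 (hub_px H) (hub_py H) (hub_pz H) (hub_pz' H) (hub_pw H).
have pw' := hub_pw' H.
have [xy xz xw' yz'] := And4 (hub_xy H) (hub_xz H) (hub_xw' H) (hub_yz' H).
have [yw zw] := conj (hub_yw H) (hub_zw H).
have [[a1y a1z a1z' a1w] [a2x a2w a2w' a2z]] := conj (hub_t1 H) (hub_t2 H).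
have [[a3x a3y a3w a3w'] [a4y a4x a4z a4z']] := conj (hub_t3 H) (hub_t4 H).
have nxz' : ~~ adj G x z' by apply/negP => h; K4 x y z' t4.
have nxw : ~~ adj G x w by apply/negP => h; K4 x z w t2.
have nyz : ~~ adj G y z by apply/negP => h; K4 x y z t4.
have nyw' : ~~ adj G y w' by apply/negP => h; K4 x y w' t3.
have nzw' : ~~ adj G z w' by apply/negP => h; K4 x z w' t2.
have nz'w : ~~ adj G z' w by apply/negP => h; K4 y z' w t1.
split=> //.
- move=> v pv vx; rewrite px in pv.
  have n3 : ~~ adj G t3 v by apply: contraNN vx => /(hub_3X H pv) ->.
  have n4 : ~~ adj G t4 v by apply: contraNN vx => /(hub_4X H pv) ->.
  have [|b [d [pb pd tb td [vb vd bd]]]] := @sat_fill _ _ _ satG t3 v (part t2) (part t4) _ n3.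
    by rewrite pv; split_uniq.
  have := hub_3Y H pb tb => eb; subst b.
  have := hub_3W H pd td; rewrite !inE => /orP[]/eqP ed; subst d; last by rewrite bd in nyw'.
  have [|b [c [pb2 pc t4b tc [_ vc bc]]]] := @sat_fill _ _ _ satG t4 v (part t2) (part t3) _ n4.
    by rewrite pv; split_uniq.
  have := hub_4Y H pb2 t4b => eb; subst b.
  have := hub_4Z H pc tc; rewrite !inE => /orP[]/eqP ec; subst c; first by rewrite bc in nyz.
  split=> //; have [t2v|t2v] := boolP (adj G t2 v).
    have t2z' : ~~ adj G t2 z' by apply: contraNN vx => h; rewrite (hub_2z' H h pv t2v).
    have [|a [d [pa pd' ta t2d [za zd ad]]]] := @sat_fill _ _ _ satG t2 z' (part t1) (part t4) _ t2z'.
      by rewrite pz'; split_uniq.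
    have ax : a != x by apply: contraNneq nxz' => <-; rewrite adjC.
    have ev := hub_2X H pa ta ax pv t2v vx; subst a.
    have := hub_2W H pd' t2d; rewrite !inE => /orP[]/eqP ed; subst d.
      by rewrite zd in nz'w.
    by rewrite ad orbT.
  have [|c [d [pc' pd' t2c t2d [vc' vd' cd]]]] := @sat_fill _ _ _ satG t2 v (part t3) (part t4) _ t2v.
    by rewrite pv; split_uniq.
  have := hub_2Z H pc' t2c; rewrite !inE => /orP[]/eqP ec; subst c; first by rewrite vc'.
  have := hub_2W H pd' t2d; rewrite !inE => /orP[]/eqP ed; subst d; last by rewrite vd' orbT.
  by rewrite cd in nz'w.
- move=> v pv vz vz'; rewrite pz in pv.
  have v_zz' : v \notin [:: z; z'] by rewrite !inE negb_or vz.
  have n4 : ~~ adj G t4 v by apply: contraNN v_zz' => /(hub_4Z H pv).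
  have n1 : ~~ adj G t1 v by apply: contraNN v_zz' => /(hub_1Z H pv).
  have n2 : ~~ adj G t2 v by apply: contraNN v_zz' => /(hub_2Z H pv).
  have [|a [b [pa pb ta tb [va vb ab]]]] := @sat_fill _ _ _ satG t4 v (part t1) (part t2) _ n4.
    by rewrite pv; split_uniq.
  have := hub_4X H pa ta => ea; have := hub_4Y H pb tb => eb; subst a b.
  have [|b [d [pb' pd t1b t1d [vb' vd bd]]]] := @sat_fill _ _ _ satG t1 v (part t2) (part t4) _ n1.
    by rewrite pv; split_uniq.
  have vw : adj G v w.
    have := hub_1W H pd t1d; rewrite !inE => /orP[]/eqP ed; subst d => //.
    have := hub_1w' H t1d pb' t1b => eb; subst b.
    by rewrite bd in nyw'.
  split=> //.
  have [|a [e [pa' pe t2a te [va' ve ae]]]] := @sat_fill _ _ _ satG t2 v (part t1) (part t4) _ n2.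
    by rewrite pv; split_uniq.
  have := hub_2W H pe te; rewrite !inE => /orP[]/eqP ee; subst e; last by left.
  right; exists a; split=> //; first by rewrite pa'.
  by apply: contraNneq nxw => <-.
- move=> nz'w' v1 v2 pv1 v1x pv2 v2x nv1 nv2.
  have key v : part v = part x -> v != x -> ~~ adj G v z -> adj G t2 v.
    move=> pv vx nv; apply: contraNT nv => n2.
    have [|c [d [pc pd t2c t2d [vc vd cd]]]] := @sat_fill _ _ _ satG t2 v (part t3) (part t4) _ n2.
      by rewrite pv px; split_uniq.
    have := hub_2Z H pc t2c; rewrite !inE => /orP[]/eqP ec; subst c => //.
    have := hub_2W H pd t2d; rewrite !inE => /orP[]/eqP ed; subst d.
      by rewrite cd in nz'w.
    by rewrite cd in nz'w'.
  by apply: (hub_2X H) => //; rewrite -?px // key.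
Qed.

Lemma hub_base t1 t2 t3 t4 x y z z' w w' :
  hub part G t1 t2 t3 t4 x y z z' w w' -> base part G x y z z' w w'.
Proof.
move=> H; have [[? ?] ? ? ? ?] := hub_one_side H.
have [[n1 n2] ? ? h0 h] := hub_one_side (hub_swap H).
split; try (by case: H) => //.
- by rewrite (hub_px H) (hub_py H) (hub_pz H) (hub_pw H) (hub_parts H).
- by rewrite (hub_pz H) (hub_pz' H).
- by rewrite (hub_pw H) (hub_pw' H).
- by move=> v pv vw vw'; have [? ? ? ?] := h0 v pv vw vw'; split.
- by rewrite adjC.
Qed.
End Hub.

(** * Quads of degree sum at most 18 *)

Section Quad.
Variables (V : finType) (part : V -> 'I_4) (G : {set {set V}}).
Hypothesis satG : saturated part G.

Definition nbh_in (t k : V) : {set V} := [set v | adj G t v & part v == part k].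

Lemma nbh_inP t k v : reflect (adj G t v /\ part v = part k) (v \in nbh_in t k).
Proof. by rewrite inE; apply: (iffP andP) => -[h /eqP]. Qed.

Lemma nbh_in_adj t k v : v \in nbh_in t k -> adj G t v.
Proof. by case/nbh_inP. Qed.

Lemma nbh_in_part t k v : v \in nbh_in t k -> part v = part k.
Proof. by case/nbh_inP. Qed.

Definition quad t1 t2 t3 t4 := uniq [:: part t1; part t2; part t3; part t4] /\
  [/\ [/\ ~~ adj G t1 t2, ~~ adj G t1 t3 & ~~ adj G t1 t4],
      ~~ adj G t2 t3, ~~ adj G t2 t4 & ~~ adj G t3 t4].

(** The shared edge of two vertices of a quad, with its ends placed in the four
    sets of neighbours that are counted later. *)
Lemma quad_pair u v k l : uniq [:: part u; part v; part k; part l] -> ~~ adj G u v ->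
  exists c d, [/\ c \in nbh_in u k, c \in nbh_in v k, d \in nbh_in u l, d \in nbh_in v l & adj G c d].
Proof.
move=> up nuv; have [c [d [pc pd uc ud [vc vd cd]]]] := sat_fill satG up nuv.
by exists c, d; split=> //; apply/nbh_inP.
Qed.

(** In the counting argument all lower bounds turn out to be tight; the
    hypotheses are the resulting upper bounds. *)
Lemma hub_intro t1 t2 t3 t4 x y z z' w w' :
    uniq [:: part t1; part t2; part t3; part t4] ->
    [/\ adj G x y, adj G x z, adj G x w' & [/\ adj G y z', adj G y w & adj G z w]] ->
    z != z' -> w != w' ->
    [/\ y \in nbh_in t1 t2, z \in nbh_in t1 t3, z' \in nbh_in t1 t3 & w \in nbh_in t1 t4] ->
    [/\ x \in nbh_in t2 t1, w \in nbh_in t2 t4, w' \in nbh_in t2 t4 & z \in nbh_in t2 t3] ->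
    [/\ x \in nbh_in t3 t1, y \in nbh_in t3 t2, w \in nbh_in t3 t4 & w' \in nbh_in t3 t4] ->
    [/\ y \in nbh_in t4 t2, x \in nbh_in t4 t1, z \in nbh_in t4 t3 & z' \in nbh_in t4 t3] ->
    [/\ #|nbh_in t3 t1| <= 1, #|nbh_in t4 t1| <= 1, #|nbh_in t3 t2| <= 1 & #|nbh_in t4 t2| <= 1] ->
    [/\ #|nbh_in t3 t4| <= 2, #|nbh_in t4 t3| <= 2, #|nbh_in t1 t3| <= 2 & #|nbh_in t2 t4| <= 2] ->
    #|nbh_in t1 t4| <= 1 + (w' \in nbh_in t1 t4) -> #|nbh_in t2 t3| <= 1 + (z' \in nbh_in t2 t3) ->
    #|nbh_in t1 t2| + (w' \in nbh_in t1 t4) <= 2 -> #|nbh_in t2 t1| + (z' \in nbh_in t2 t3) <= 2 ->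
  hub part G t1 t2 t3 t4 x y z z' w w'.
Proof.
move=> up [xy xz xw' [yz' yw zw]] zz' ww' [y1 z1 z1' w1] [x2 w2 w2' z2] [x3 y3 w3 w3'].
move=> [y4 x4 z4 z4'] [n31 n41 n32 n42] [n34 n43 n13 n24] n14 n23 n12 n21.
have z'z : z' != z by rewrite eq_sym.
have w'w : w' != w by rewrite eq_sym.
split=> //.
1-6: by [exact: nbh_in_part x3|exact: nbh_in_part y3|exact: nbh_in_part z1|exact: nbh_in_part z1'|
  exact: nbh_in_part w1|exact: nbh_in_part w2'].
- by split; [exact: nbh_in_adj y1|exact: nbh_in_adj z1|exact: nbh_in_adj z1'|exact: nbh_in_adj w1].
- by split; [exact: nbh_in_adj x2|exact: nbh_in_adj w2|exact: nbh_in_adj w2'|exact: nbh_in_adj z2].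
- by split; [exact: nbh_in_adj x3|exact: nbh_in_adj y3|exact: nbh_in_adj w3|exact: nbh_in_adj w3'].
- by split; [exact: nbh_in_adj y4|exact: nbh_in_adj x4|exact: nbh_in_adj z4|exact: nbh_in_adj z4'].
- by move=> v pv tv; apply: (mem_card_le1 x3 n31); apply/nbh_inP.
- by move=> v pv tv; apply: (mem_card_le1 x4 n41); apply/nbh_inP.
- by move=> v pv tv; apply: (mem_card_le1 y3 n32); apply/nbh_inP.
- by move=> v pv tv; apply: (mem_card_le1 y4 n42); apply/nbh_inP.
- by move=> v pv tv; apply: (mem_card_le2 ww' w3 w3' n34); apply/nbh_inP.
- by move=> v pv tv; apply: (mem_card_le2 zz' z4 z4' n43); apply/nbh_inP.
- by move=> v pv tv; apply: (mem_card_le2 zz' z1 z1' n13); apply/nbh_inP.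
- by move=> v pv tv; apply: (mem_card_le2_if ww' w1 n14); apply/nbh_inP.
- by move=> v pv tv; apply: (mem_card_le2_if zz' z2 n23); apply/nbh_inP.
- by move=> v pv tv; apply: (mem_card_le2 ww' w2 w2' n24); apply/nbh_inP.
- move=> v1 v2 p1 a1 d1 p2 a2 d2; apply: (eq_mem_card_le2 y1) => //; try exact/nbh_inP.
  by apply: leq_trans n12; rewrite leq_addr.
- move=> v1 v2 p1 a1 d1 p2 a2 d2; apply: (eq_mem_card_le2 x2) => //; try exact/nbh_inP.
  by apply: leq_trans n21; rewrite leq_addr.
- move=> a1 v pv tv; apply: (mem_card_le1 y1); last exact/nbh_inP.
  have w1' : w' \in nbh_in t1 t4 by apply/nbh_inP; case/nbh_inP: w2'.
  by rewrite w1' addn1 in n12.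
- move=> a2 v pv tv; apply: (mem_card_le1 x2); last exact/nbh_inP.
  have z2' : z' \in nbh_in t2 t3 by apply/nbh_inP; case/nbh_inP: z1'.
  by rewrite z2' addn1 in n21.
Qed.

Ltac K4_in a b c d := exfalso; apply: (@sat_free _ _ _ satG a b c d);
  first [by_adj | apply: nbh_in_adj; eassumption | rewrite adjC; apply: nbh_in_adj; eassumption].

(** Parts that receive at most 4 edges from the quad have a hub.  With hubs x
    and y, the shared edges x z13 and y z23 have distinct ends z13 and z23, or
    x, y and their common end would form a triangle in N(t4); the ends w14 and w24
    of the shared edges x w14 and y w24 differ likewise, because of N(t3).  If t1
    misses z13 or w14, then t1 has a second neighbour in the part of y; the same
    holds for t2, with z23, w24 and x.  The edge z34 w34 shared by t1 and t2 must
    use these vertices, or the degree sum exceeds 18; it cannot close a triangle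
    with x in N(t2) or with y in N(t1), so it is z13 w24 or z23 w14.  Both cases
    are the hub configuration, up to exchanging the hubs. *)
Lemma two_hubs t1 t2 t3 t4 : quad t1 t2 t3 t4 ->
    #|nbh_in t2 t1| + #|nbh_in t3 t1| + #|nbh_in t4 t1| <= 4 ->
    #|nbh_in t1 t2| + #|nbh_in t3 t2| + #|nbh_in t4 t2| <= 4 ->
    (#|nbh_in t1 t2| + #|nbh_in t1 t3| + #|nbh_in t1 t4|) +
    (#|nbh_in t2 t1| + #|nbh_in t2 t3| + #|nbh_in t2 t4|) +
    (#|nbh_in t3 t1| + #|nbh_in t3 t2| + #|nbh_in t3 t4|) +
    (#|nbh_in t4 t1| + #|nbh_in t4 t2| + #|nbh_in t4 t3|) <= 18 ->
  exists x y z z' w w', base part G x y z z' w w'.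
Proof.
move=> [up [[n12 n13 n14] n23 n24 n34]] c1 c2 D.
have := up; rewrite /= !inE !negb_or => /and4P[/and3P[p12 p13 p14] /andP[p23 p24] p34 _].
have [|x [y [x3 x4 y3 y4 xy]]] := @quad_pair t3 t4 t1 t2 _ n34; first by split_uniq.
have [|x13 [z13 [x2 x4' z2 z4 xz]]] := @quad_pair t2 t4 t1 t3 _ n24; first by split_uniq.
have [|x14 [w14 [x2' x3' w2 w3 xw]]] := @quad_pair t2 t3 t1 t4 _ n23; first by split_uniq.
have [|y23 [z23 [y1 y4' z1 z4' yz]]] := @quad_pair t1 t4 t2 t3 _ n14; first by split_uniq.
have [|y24 [w24 [y1' y3' w1 w3' yw]]] := @quad_pair t1 t3 t2 t4 _ n13; first by split_uniq.
have [|z34 [w34 [z1' z2' w1' w2' zw]]] := @quad_pair t1 t2 t3 t4 _ n12; first by split_uniq.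
have [e1 e2] : x14 = x /\ x14 = x13 by apply: (common_end _ _ _ c1); split.
have [e3 e4] : y24 = y /\ y24 = y23 by apply: (common_end _ _ _ c2); split.
rewrite e1 in e2; rewrite e3 in e4; subst x13 x14 y23 y24; clear x2' x4' x3' y1' y4' y3'.
have zz : z13 != z23 by apply/eqP => e; subst z23; K4_in x y z13 t4.
have ww : w14 != w24 by apply/eqP => e; subst w24; K4_in x y w14 t3.
have nxz : ~~ adj G x z23 by apply/negP => e; K4_in x y z23 t4.
have nyz : ~~ adj G y z13 by apply/negP => e; K4_in x y z13 t4.
have nxw : ~~ adj G x w24 by apply/negP => e; K4_in x y w24 t3.
have nyw : ~~ adj G y w14 by apply/negP => e; K4_in x y w14 t3.
have pz13 := nbh_in_part z2; have pz23 := nbh_in_part z1.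
have pw14 := nbh_in_part w2; have pw24 := nbh_in_part w1.
(* If t is not adjacent to v, their shared edge has an end in the part of the hub h
   other than h, since h is not adjacent to v. *)
have extra t k u v : uniq [:: part t; part v; part k; part u] -> forall h, h \in nbh_in t k ->
    ~~ adj G h v -> 2 <= #|nbh_in t k| + (v \in nbh_in t v).
  move=> upt h ht nhv; have [vt|vt] := boolP (v \in nbh_in t v).
    by rewrite addn1 ltnS; apply: (@card_ge_size _ _ [:: h]); rewrite //= ht.
  have ntv : ~~ adj G t v by apply: contra vt => ?; apply/nbh_inP.
  have [c [d [tc vc _ _ _]]] := quad_pair upt ntv.
  rewrite addn0; apply: (@card_ge_size _ _ [:: h; c]); last by rewrite /= ht tc.
  by rewrite /= inE andbT; apply: contraNneq nhv => ->; rewrite adjC; apply: nbh_in_adj vc.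
have nbh_in_eq t u v : part u = part v -> nbh_in t u = nbh_in t v.
  by move=> e; apply/setP => a; rewrite !inE e.
have a1 : 2 <= #|nbh_in t2 t1| + (z23 \in nbh_in t2 t3).
  rewrite -(nbh_in_eq t2 _ _ pz23); apply: (extra _ _ t4 _ _ x) => //.
  by rewrite pz23; split_uniq.
have a2 : 2 <= #|nbh_in t2 t1| + (w24 \in nbh_in t2 t4).
  rewrite -(nbh_in_eq t2 _ _ pw24); apply: (extra _ _ t3 _ _ x) => //.
  by rewrite pw24; split_uniq.
have a3 : 2 <= #|nbh_in t1 t2| + (z13 \in nbh_in t1 t3).
  rewrite -(nbh_in_eq t1 _ _ pz13); apply: (extra _ _ t4 _ _ y) => //.
  by rewrite pz13; split_uniq.
have a4 : 2 <= #|nbh_in t1 t2| + (w14 \in nbh_in t1 t4).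
  rewrite -(nbh_in_eq t1 _ _ pw14); apply: (extra _ _ t3 _ _ y) => //.
  by rewrite pw14; split_uniq.
have zz' : z23 != z13 by rewrite eq_sym.
have ww' : w24 != w14 by rewrite eq_sym.
have m13 : 1 + (z13 \in nbh_in t1 t3) <= #|nbh_in t1 t3|.
  by apply: (@card_cons _ _ z13 [:: z23]); rewrite /= ?z1 //; split_uniq.
have m23 : 1 + (z23 \in nbh_in t2 t3) <= #|nbh_in t2 t3|.
  by apply: (@card_cons _ _ z23 [:: z13]); rewrite /= ?z2 //; split_uniq.
have m14 : 1 + (w14 \in nbh_in t1 t4) <= #|nbh_in t1 t4|.
  by apply: (@card_cons _ _ w14 [:: w24]); rewrite /= ?w1 //; split_uniq.
have m24 : 1 + (w24 \in nbh_in t2 t4) <= #|nbh_in t2 t4|.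
  by apply: (@card_cons _ _ w24 [:: w14]); rewrite /= ?w2 //; split_uniq.
have m34 : 2 <= #|nbh_in t3 t4|.
  by apply: (@card_ge_size _ _ [:: w14; w24]); rewrite /= ?w3 ?w3' //; split_uniq.
have m43 : 2 <= #|nbh_in t4 t3|.
  by apply: (@card_ge_size _ _ [:: z13; z23]); rewrite /= ?z4 ?z4' //; split_uniq.
have [m31 m32] : 1 <= #|nbh_in t3 t1| /\ 1 <= #|nbh_in t3 t2|.
  by split; [apply: (@card_ge_size _ _ [:: x])|apply: (@card_ge_size _ _ [:: y])]; rewrite /= ?x3 ?y3.
have [m41 m42] : 1 <= #|nbh_in t4 t1| /\ 1 <= #|nbh_in t4 t2|.
  by split; [apply: (@card_ge_size _ _ [:: x])|apply: (@card_ge_size _ _ [:: y])]; rewrite /= ?x4 ?y4.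
have other_z : z34 != z13 -> z34 != z23 ->
    2 + (z13 \in nbh_in t1 t3) <= #|nbh_in t1 t3| /\ 2 + (z23 \in nbh_in t2 t3) <= #|nbh_in t2 t3|.
  move=> h1 h2; split.
    by apply: (@card_cons _ _ z13 [:: z23; z34]); rewrite /= ?z1 ?z1' //; split_uniq.
  by apply: (@card_cons _ _ z23 [:: z13; z34]); rewrite /= ?z2 ?z2' //; split_uniq.
have other_w : w34 != w14 -> w34 != w24 ->
    2 + (w14 \in nbh_in t1 t4) <= #|nbh_in t1 t4| /\ 2 + (w24 \in nbh_in t2 t4) <= #|nbh_in t2 t4|.
  move=> h1 h2; split.
    by apply: (@card_cons _ _ w14 [:: w24; w34]); rewrite /= ?w1 ?w1' //; split_uniq.
  by apply: (@card_cons _ _ w24 [:: w14; w34]); rewrite /= ?w2 ?w2' //; split_uniq.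
have cz : [\/ z34 = z13 /\ (z13 \in nbh_in t1 t3) = 1 :> nat,
    z34 = z23 /\ (z23 \in nbh_in t2 t3) = 1 :> nat |
    2 + (z13 \in nbh_in t1 t3) <= #|nbh_in t1 t3| /\ 2 + (z23 \in nbh_in t2 t3) <= #|nbh_in t2 t3|].
  have [ez|h1] := eqVneq z34 z13; first by constructor 1; rewrite -ez z1'.
  by have [ez|h2] := eqVneq z34 z23; [constructor 2; rewrite -ez z2'|constructor 3; apply: other_z].
have cw : [\/ w34 = w14 /\ (w14 \in nbh_in t1 t4) = 1 :> nat,
    w34 = w24 /\ (w24 \in nbh_in t2 t4) = 1 :> nat |
    2 + (w14 \in nbh_in t1 t4) <= #|nbh_in t1 t4| /\ 2 + (w24 \in nbh_in t2 t4) <= #|nbh_in t2 t4|].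
  have [ez|h1] := eqVneq w34 w14; first by constructor 1; rewrite -ez w1'.
  by have [ez|h2] := eqVneq w34 w24; [constructor 2; rewrite -ez w2'|constructor 3; apply: other_w].
have notzw13 : z34 = z13 -> w34 = w14 -> False by move=> ? ?; subst z34 w34; K4_in x z13 w14 t2.
have notzw23 : z34 = z23 -> w34 = w24 -> False by move=> ? ?; subst z34 w34; K4_in y z23 w24 t1.
have {c1 c2} ends : ((z34 = z13 /\ w34 = w24) /\
    (z13 \in nbh_in t1 t3) + (w24 \in nbh_in t2 t4) = 2) \/ ((z34 = z23 /\ w34 = w14) /\
    (z23 \in nbh_in t2 t3) + (w14 \in nbh_in t1 t4) = 2).
  move: D a1 a2 a3 a4 m13 m14 m23 m24 m34 m43 m31 m32 m41 m42 cz cw notzw13 notzw23.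
  move: (z13 \in nbh_in t1 t3 : nat) (z23 \in nbh_in t2 t3 : nat) (w14 \in nbh_in t1 t4 : nat) (w24 \in nbh_in t2 t4 : nat).
  move: #|nbh_in t1 t2| #|nbh_in t1 t3| #|nbh_in t1 t4| #|nbh_in t2 t1| #|nbh_in t2 t3| #|nbh_in t2 t4|.
  move: #|nbh_in t3 t1| #|nbh_in t3 t2| #|nbh_in t3 t4| #|nbh_in t4 t1| #|nbh_in t4 t2| #|nbh_in t4 t3|.
  clear=> d31 d32 d34 d41 d42 d43 d12 d13 d14 d21 d23 d24 b a d c.
  move=> D a1 a2 a3 a4 m13 m14 m23 m24 m34 m43 m31 m32 m41 m42.
  move=> [[ez e1]|[ez e1]|[e1 e1']] [[ew e2]|[ew e2]|[e2 e2']] no1 no2.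
  - by case: (no1 ez ew).
  - by left; split=> //; lia.
  - by exfalso; clear - D a1 a2 a3 a4 m13 m14 m23 m24 m34 m43 m31 m32 m41 m42 e1 e2 e2'; lia.
  - by right; split=> //; lia.
  - by case: (no2 ez ew).
  - by exfalso; clear - D a1 a2 a3 a4 m13 m14 m23 m24 m34 m43 m31 m32 m41 m42 e1 e2 e2'; lia.
  - by exfalso; clear - D a1 a2 a3 a4 m13 m14 m23 m24 m34 m43 m31 m32 m41 m42 e1 e1' e2; lia.
  - by exfalso; clear - D a1 a2 a3 a4 m13 m14 m23 m24 m34 m43 m31 m32 m41 m42 e1 e1' e2; lia.
  - by exfalso; clear - D a1 a2 a3 a4 m13 m14 m23 m24 m34 m43 m31 m32 m41 m42 e1 e1' e2 e2'; lia.
have numbers : [/\ [/\ #|nbh_in t3 t1| <= 1, #|nbh_in t4 t1| <= 1, #|nbh_in t3 t2| <= 1 & #|nbh_in t4 t2| <= 1],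
    #|nbh_in t3 t4| <= 2, #|nbh_in t4 t3| <= 2,
    [/\ #|nbh_in t1 t3| <= 1 + (z13 \in nbh_in t1 t3), #|nbh_in t2 t3| <= 1 + (z23 \in nbh_in t2 t3),
        #|nbh_in t1 t4| <= 1 + (w14 \in nbh_in t1 t4) & #|nbh_in t2 t4| <= 1 + (w24 \in nbh_in t2 t4)] &
    ((z13 \in nbh_in t1 t3) + (w24 \in nbh_in t2 t4) = 2 ->
      #|nbh_in t2 t1| + (z23 \in nbh_in t2 t3) <= 2 /\ #|nbh_in t1 t2| + (w14 \in nbh_in t1 t4) <= 2) /\
    ((z23 \in nbh_in t2 t3) + (w14 \in nbh_in t1 t4) = 2 ->
      #|nbh_in t2 t1| + (w24 \in nbh_in t2 t4) <= 2 /\ #|nbh_in t1 t2| + (z13 \in nbh_in t1 t3) <= 2)].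
  have {ends} : (z13 \in nbh_in t1 t3) + (w24 \in nbh_in t2 t4) = 2 \/
    (z23 \in nbh_in t2 t3) + (w14 \in nbh_in t1 t4) = 2 by case: ends => [[_]|[_]]; [left|right].
  move: D a1 a2 a3 a4 m13 m14 m23 m24 m34 m43 m31 m32 m41 m42.
  have := (leq_b1 (z13 \in nbh_in t1 t3), leq_b1 (z23 \in nbh_in t2 t3),
           leq_b1 (w14 \in nbh_in t1 t4), leq_b1 (w24 \in nbh_in t2 t4)).
  move: (z13 \in nbh_in t1 t3 : nat) (z23 \in nbh_in t2 t3 : nat) (w14 \in nbh_in t1 t4 : nat) (w24 \in nbh_in t2 t4 : nat).
  move: #|nbh_in t1 t2| #|nbh_in t1 t3| #|nbh_in t1 t4| #|nbh_in t2 t1| #|nbh_in t2 t3| #|nbh_in t2 t4|.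
  move: #|nbh_in t3 t1| #|nbh_in t3 t2| #|nbh_in t3 t4| #|nbh_in t4 t1| #|nbh_in t4 t2| #|nbh_in t4 t3|.
  clear=> d31 d32 d34 d41 d42 d43 d12 d13 d14 d21 d23 d24 b a d c [[[? ?] ?] ?].
  move=> D a1 a2 a3 a4 m13 m14 m23 m24 m34 m43 m31 m32 m41 m42.
  by case=> e; split; try split; try (move=> e'; split); lia.
have {numbers} [[n1 n2 n3 n4] n5 n6 [n7 n8 n9 n10] [num1 num2]] := numbers.
case: ends => [[[ez ew] /num1[n11 n12']]|[[ez ew] /num2[n11 n12']]]; subst z34 w34.
- rewrite z1' in n7; rewrite w2' in n10.
  exists x, y, z13, z23, w24, w14; apply: (@hub_base _ _ _ satG t1 t2 t3 t4).
  by apply: hub_intro => //; split.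
- rewrite z2' in n8; rewrite w1' in n9.
  exists y, x, z23, z13, w14, w24; apply: (@hub_base _ _ _ satG t2 t1 t3 t4).
  by apply: hub_intro => //; first split_uniq; split=> //; rewrite adjC.
Qed.

(** Here x is the only neighbour of a and b in its part, so a vertex of the part
    of s that a or b misses shares with it an edge at x, and is a neighbour of x.
    With five incidences in the part of s, either x sees all the ends there, or
    the two ends seen by t1 coincide and the third end is not seen by t1. *)
Lemma one_hub_end t1 s a b x p q r : quad t1 s a b ->
    #|nbh_in t1 s| + #|nbh_in a s| + #|nbh_in b s| <= 5 ->
    #|nbh_in a t1| <= 1 -> #|nbh_in b t1| <= 1 -> x \in nbh_in a t1 -> x \in nbh_in b t1 ->
    p \in nbh_in a s -> p \in nbh_in b s -> adj G x p ->
    q \in nbh_in t1 s -> q \in nbh_in a s -> r \in nbh_in t1 s -> r \in nbh_in b s ->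
  (adj G x q /\ adj G x r) \/ [/\ q = r, p != q & #|nbh_in t1 s| <= 1].
Proof.
move=> [up _] c5 na nb xa xb pa pb xp q1 qa r1 rb.
have := up; rewrite /= !inE !negb_or => /and4P[/and3P[u1 u2 u3] /andP[u4 u5] u6 _].
have reach c d v : #|nbh_in c t1| <= 1 -> x \in nbh_in c t1 -> v \notin nbh_in c s -> part v = part s ->
    uniq [:: part c; part s; part t1; part d] -> adj G x v.
  move=> nc xc vc pv uc; have nv : ~~ adj G c v by apply: contra vc => cv; apply/nbh_inP.
  have [|x' [d' [x'c x'v _ _ _]]] := @quad_pair c v t1 d _ nv; first by rewrite pv.
  by rewrite -(mem_card_le1 xc nc x'c) adjC; apply: nbh_in_adj x'v.
have [qr|qr] := eqVneq q r.
  subst r; have [pq|pq] := eqVneq p q; first by subst q; left.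
  right; split=> //; have := two_mem_card pq pa qa; have := two_mem_card pq pb rb.
  by move: c5; clear; lia.
have A2 := two_mem_card qr q1 r1; left.
have [pq|pq] := eqVneq p q.
  subst q; split=> //; apply: (reach a b) => //; last by split_uniq.
    apply/negP => ra; have := two_mem_card qr qa ra; have := two_mem_card qr pb rb.
    by move: c5 A2; clear; lia.
  exact: nbh_in_part r1.
have [pr|pr] := eqVneq p r.
  subst r; split=> //; apply: (reach b a) => //; last by split_uniq.
    apply/negP => qb; have := two_mem_card qr qa pa; have := two_mem_card qr qb rb.
    by move: c5 A2; clear; lia.
  exact: nbh_in_part q1.
have := two_mem_card pq pa qa; have := two_mem_card pr pb rb.
by move: c5 A2; clear; lia.
Qed.

(** Two parts of the second kind of [one_hub_end].  The ends y and z are adjacent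
    because they are the edge shared by t1 and t4.  So no vertex of N(t1) in the
    fourth part sees both, w24 and w34 differ, and w14 is one of them.  As t1
    misses y' and z', the edge it shares with one of them ends in w14, which
    together with x closes a triangle in N(t2) or N(t3). *)
Lemma one_hub_two_parts t1 t2 t3 t4 x y y' z z' w14 w24 w34 : quad t1 t2 t3 t4 ->
    [/\ x \in nbh_in t2 t1, x \in nbh_in t3 t1 & #|nbh_in t1 t4| + #|nbh_in t2 t4| + #|nbh_in t3 t4| <= 5] ->
    [/\ y' \in nbh_in t3 t2, adj G x y', y \in nbh_in t1 t2, y' != y & #|nbh_in t1 t2| <= 1] ->
    [/\ z' \in nbh_in t2 t3, adj G x z', z \in nbh_in t1 t3, z' != z & #|nbh_in t1 t3| <= 1] ->
    adj G y z ->
    [/\ w14 \in nbh_in t2 t4, w14 \in nbh_in t3 t4 & adj G x w14] ->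
    [/\ w24 \in nbh_in t1 t4, w24 \in nbh_in t3 t4 & adj G y w24] ->
    [/\ w34 \in nbh_in t1 t4, w34 \in nbh_in t2 t4 & adj G z w34] -> False.
Proof.
move=> [up _] [x2 x3 c4] [y'3 xy' y1 yy' ny] [z'2 xz' z1 zz' nz] yz.
move=> [w2 w3 xw] [w1 w3' yw] [w1' w2' zw].
have := up; rewrite /= !inE !negb_or => /and4P[/and3P[u1 u2 u3] /andP[u4 u5] u6 _].
have ww : w24 != w34 by apply/eqP => e; subst w34; K4_in y z w24 t1.
have n4 := two_mem_card ww w1 w1'.
have pz' := nbh_in_part z'2; have py' := nbh_in_part y'3.
have in1 : #|nbh_in t1 t4| <= 2 /\ (w14 = w24 \/ w14 = w34).
  have [e|e1] := eqVneq w14 w24.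
    subst w14; split; last by left.
    by have := two_mem_card ww w2 w2'; have : 0 < #|nbh_in t3 t4| by [apply/card_gt0P; exists w24]; move: c4 n4; clear; lia.
  have m3 := two_mem_card e1 w3 w3'; have [e|e2] := eqVneq w14 w34.
    subst w14; split; last by right.
    by have : 0 < #|nbh_in t2 t4| by [apply/card_gt0P; exists w34]; move: c4 n4 m3; clear; lia.
  by have := two_mem_card e2 w2 w2'; move: c4 n4 m3; clear; lia.
have {in1} [n14 [e|e]] := in1; subst w14.
- have nz' : ~~ adj G t1 z'.
    apply: contra zz' => h; apply/eqP; apply: (mem_card_le1 z1 nz); exact/nbh_inP.
  have [|b [d [b1 bz' d1 dz' bd]]] := @quad_pair t1 z' t2 t4 _ nz'.
    by rewrite pz'; split_uniq.
  have eb := mem_card_le1 y1 ny b1; subst b.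
  have := mem_card_le2 ww w1 w1' n14 d1; rewrite !inE => /orP[]/eqP ed; subst d.
    by K4_in x z' w24 t2.
  by K4_in y z w34 t1.
- have ny' : ~~ adj G t1 y'.
    apply: contra yy' => h; apply/eqP; apply: (mem_card_le1 y1 ny); exact/nbh_inP.
  have [|b [d [b1 bz' d1 dz' bd]]] := @quad_pair t1 y' t3 t4 _ ny'.
    by rewrite py'; split_uniq.
  have eb := mem_card_le1 z1 nz b1; subst b.
  have := mem_card_le2 ww w1 w1' n14 d1; rewrite !inE => /orP[]/eqP ed; subst d.
    by K4_in y z w24 t1.
  by K4_in x y' w34 t3.
Qed.

(** The remaining distribution of degree sum 18 over the parts, 3 + 5 + 5 + 5,
    is impossible.  If x sees all the ends in two parts, it forms a triangle with
    the edge shared between these parts, inside a neighbourhood.  So two parts are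
    of the second kind. *)
Lemma one_hub t1 t2 t3 t4 : quad t1 t2 t3 t4 ->
    #|nbh_in t2 t1| + #|nbh_in t3 t1| + #|nbh_in t4 t1| <= 3 ->
    #|nbh_in t1 t2| + #|nbh_in t3 t2| + #|nbh_in t4 t2| <= 5 ->
    #|nbh_in t1 t3| + #|nbh_in t2 t3| + #|nbh_in t4 t3| <= 5 ->
    #|nbh_in t1 t4| + #|nbh_in t2 t4| + #|nbh_in t3 t4| <= 5 -> False.
Proof.
move=> Q c1 c2 c3 c4; have [up [[n12 n13 n14] n23 n24 n34]] := Q.
have := up; rewrite /= !inE !negb_or => /and4P[/and3P[p12 p13 p14] /andP[p23 p24] p34 _].
have [|x [y12 [x3 x4 y3 y4 xy]]] := @quad_pair t3 t4 t1 t2 _ n34; first by split_uniq.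
have [|x13 [z13 [x2 x4' z2 z4 xz]]] := @quad_pair t2 t4 t1 t3 _ n24; first by split_uniq.
have [|x14 [w14 [x2' x3' w2 w3 xw]]] := @quad_pair t2 t3 t1 t4 _ n23; first by split_uniq.
have [|y23 [z23 [y1 y4' z1 z4' yz]]] := @quad_pair t1 t4 t2 t3 _ n14; first by split_uniq.
have [|y24 [w24 [y1' y3' w1 w3' yw]]] := @quad_pair t1 t3 t2 t4 _ n13; first by split_uniq.
have [|z34 [w34 [z1' z2' w1' w2' zw]]] := @quad_pair t1 t2 t3 t4 _ n12; first by split_uniq.
have [e1 e2] : x14 = x /\ x14 = x13 by apply: (common_end _ _ _ (leqW c1)); split.
rewrite e1 in e2; subst x13 x14; clear x2' x4' x3'.
have gt0 (A : {set V}) v : v \in A -> 0 < #|A| by move=> vA; apply/card_gt0P; exists v.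
have m2 := gt0 _ _ x2; have m3 := gt0 _ _ x3; have m4 := gt0 _ _ x4.
have [k2 k3 k4] : [/\ #|nbh_in t2 t1| <= 1, #|nbh_in t3 t1| <= 1 & #|nbh_in t4 t1| <= 1].
  by move: c1 m2 m3 m4; clear => *; split; lia.
have Q3 : quad t1 t3 t2 t4.
  by split; [split_uniq|split; [split| | |]; by_adj].
have Q4 : quad t1 t4 t2 t3.
  by split; [split_uniq|split; [split| | |]; by_adj].
have := @one_hub_end t1 t2 t3 t4 x y12 y24 y23 Q c2 k3 k4 x3 x4 y3 y4 xy y1' y3' y1 y4'.
have := @one_hub_end t1 t3 t2 t4 x z13 z34 z23 Q3 c3 k2 k4 x2 x4 z2 z4 xz z1' z2' z1 z4'.
have := @one_hub_end t1 t4 t2 t3 x w14 w34 w24 Q4 c4 k2 k3 x2 x3 w2 w3 xw w1' w2' w1 w3'.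
move=> [[xw34 xw24]|[ew nw nw1]] [[xz34 xz23]|[ez nz nz1]] [[xy24 xy23]|[ey ny ny1]].
all: try (by K4_in x y23 z23 t4); try (by K4_in x y24 w24 t3); try (by K4_in x z34 w34 t2).
- subst y24 z34.
  by apply: (@one_hub_two_parts t1 t2 t3 t4 x y23 y12 z23 z13 w14 w24 w34).
- subst y24 w34.
  apply: (@one_hub_two_parts t1 t2 t4 t3 x y23 y12 w24 w14 z13 z23 z34) => //.
  + by split; [split_uniq|split; [split| | |]; by_adj].
  + by split=> //; rewrite adjC.
- subst z34 w34.
  apply: (@one_hub_two_parts t1 t3 t4 t2 x z23 z13 w24 w14 y12 y23 y24) => //.
  + by split; [split_uniq|split; [split| | |]; by_adj].
  + by split=> //; rewrite adjC.
  + by split=> //; rewrite adjC.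
- subst y24 z34.
  by apply: (@one_hub_two_parts t1 t2 t3 t4 x y23 y12 z23 z13 w14 w24 w34).
Qed.

Ltac permute_quad :=
  split; [split_uniq|split; [split| | |]; by_adj].

Lemma quad_nbh_in_gt0 t1 t2 t3 t4 : quad t1 t2 t3 t4 ->
  [/\ 0 < #|nbh_in t1 t2|, 0 < #|nbh_in t1 t3| & 0 < #|nbh_in t1 t4|].
Proof.
move=> [up [[n12 n13 n14] _ _ _]].
have := up; rewrite /= !inE !negb_or => /and4P[/and3P[p12 p13 p14] /andP[p23 p24] p34 _].
have [|y [z [y1 _ z1 _ _]]] := @quad_pair t1 t4 t2 t3 _ n14; first by split_uniq.
have [|c [d [_ _ d1 _ _]]] := @quad_pair t1 t3 t2 t4 _ n13; first by split_uniq.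
by split; apply/card_gt0P; [exists y|exists z|exists d].
Qed.

Lemma quad_nbh_in_le t1 t2 t3 t4 : quad t1 t2 t3 t4 ->
  #|nbh_in t1 t2| + #|nbh_in t1 t3| + #|nbh_in t1 t4| <= #|nbh G t1|.
Proof.
move=> [up _]; have := up; rewrite /= !inE !negb_or => /and4P[_ /andP[p23 p24] p34 _].
have disj k l : part k != part l -> nbh_in t1 k :&: nbh_in t1 l = set0.
  move=> pkl; apply/setP => v; rewrite !inE; apply/negP => /andP[/andP[_ /eqP h] /andP[_ /eqP h']].
  by rewrite -h h' eqxx in pkl.
apply: (@leq_trans #|nbh_in t1 t2 :|: nbh_in t1 t3 :|: nbh_in t1 t4|).
  rewrite cardsU setIUl !disj // setU0 cards0 subn0 cardsU disj // cards0 subn0 //.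
by apply/subset_leq_card/subsetP => v; rewrite !inE -!andb_orr => /andP[].
Qed.

(** Each part receives at least 3 edges from the quad.  Either two parts receive
    at most 4, or three parts receive at least 5 and then exactly 5. *)
Lemma quad_base t1 t2 t3 t4 : quad t1 t2 t3 t4 ->
    #|nbh G t1| + #|nbh G t2| + #|nbh G t3| + #|nbh G t4| <= 18 ->
  exists x y z z' w w', base part G x y z z' w w'.
Proof.
move=> Q D; have [up [[n12 n13 n14] n23 n24 n34]] := Q.
have := up; rewrite /= !inE !negb_or => /and4P[/and3P[p12 p13 p14] /andP[p23 p24] p34 _].
have Q2 : quad t2 t1 t3 t4 by permute_quad.
have Q3 : quad t3 t1 t2 t4 by permute_quad.
have Q4 : quad t4 t1 t2 t3 by permute_quad.
have [g12 g13 g14] := quad_nbh_in_gt0 Q; have [g21 g23 g24] := quad_nbh_in_gt0 Q2.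
have [g31 g32 g34] := quad_nbh_in_gt0 Q3; have [g41 g42 g43] := quad_nbh_in_gt0 Q4.
have {D} : (#|nbh_in t1 t2| + #|nbh_in t1 t3| + #|nbh_in t1 t4|) +
    (#|nbh_in t2 t1| + #|nbh_in t2 t3| + #|nbh_in t2 t4|) +
    (#|nbh_in t3 t1| + #|nbh_in t3 t2| + #|nbh_in t3 t4|) +
    (#|nbh_in t4 t1| + #|nbh_in t4 t2| + #|nbh_in t4 t3|) <= 18.
  by apply: leq_trans D; rewrite !leq_add // quad_nbh_in_le.
have T12 := two_hubs Q.
have T13 : _ := @two_hubs t1 t3 t2 t4 _; have T14 : _ := @two_hubs t1 t4 t2 t3 _.
have T23 : _ := @two_hubs t2 t3 t1 t4 _; have T24 : _ := @two_hubs t2 t4 t1 t3 _.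
have T34 : _ := @two_hubs t3 t4 t1 t2 _.
have O1 := one_hub Q; have O2 := one_hub Q2; have O3 := one_hub Q3; have O4 := one_hub Q4.
have {}T13 := T13 (ltac:(permute_quad)).
have {}T14 := T14 (ltac:(permute_quad)).
have {}T23 := T23 (ltac:(permute_quad)).
have {}T24 := T24 (ltac:(permute_quad)).
have {}T34 := T34 (ltac:(permute_quad)).
move: g12 g13 g14 g21 g23 g24 g31 g32 g34 g41 g42 g43 T12 T13 T14 T23 T24 T34 O1 O2 O3 O4.
move: #|nbh_in t1 t2| #|nbh_in t1 t3| #|nbh_in t1 t4| #|nbh_in t2 t1| #|nbh_in t2 t3| #|nbh_in t2 t4|.
move: #|nbh_in t3 t1| #|nbh_in t3 t2| #|nbh_in t3 t4| #|nbh_in t4 t1| #|nbh_in t4 t2| #|nbh_in t4 t3|.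
set P := exists _, _; move: P => P.
clear=> d31 d32 d34 d41 d42 d43 d12 d13 d14 d21 d23 d24.
move=> g12 g13 g14 g21 g23 g24 g31 g32 g34 g41 g42 g43 T12 T13 T14 T23 T24 T34 O1 O2 O3 O4 D.
have [c1|c1] := leqP (d21 + d31 + d41) 4; have [c2|c2] := leqP (d12 + d32 + d42) 4.
- by apply: T12; lia.
- have [c3|c3] := leqP (d13 + d23 + d43) 4; first by apply: T13; lia.
  have [c4|c4] := leqP (d14 + d24 + d34) 4; first by apply: T14; lia.
  by exfalso; apply: O1; lia.
- have [c3|c3] := leqP (d13 + d23 + d43) 4; first by apply: T23; lia.
  have [c4|c4] := leqP (d14 + d24 + d34) 4; first by apply: T24; lia.
  by exfalso; apply: O2; lia.
have [c3|c3] := leqP (d13 + d23 + d43) 4; have [c4|c4] := leqP (d14 + d24 + d34) 4.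
- by apply: T34; lia.
- by exfalso; apply: O3; lia.
- by exfalso; apply: O4; lia.
- by exfalso; lia.
Qed.
End Quad.

(** * Existence of a quad of degree sum at most 18 *)

(** A crude form of the Bollobas inequality for set pairs.  All F i with i other
    than a fixed i0 meet H i0; those that contain a given x of H i0 can drop x,
    because then x is not in their own H i, and so in none of the H j
    concerned. *)
Lemma cross_intersecting_bound (I T : finType) (F H : I -> {set T}) (a b : nat)
    (J : {set I}) :
    (forall i, i \in J -> #|F i| <= a) -> (forall i, i \in J -> #|H i| <= b) ->
    (forall i, i \in J -> [disjoint F i & H i]) ->
    (forall i j, i \in J -> j \in J -> i != j -> ~~ [disjoint F i & H j]) ->
  #|J| <= (b + 1) ^ a.
Proof.
elim: a F J => [|a IH] F J Fa Hb FH cross.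
  rewrite expn0 leqNgt; apply/negP => /card_gt1P[i [j [iJ jJ ij]]].
  have F0 : F i = set0 by apply/eqP; rewrite -cards_eq0 -leqn0 Fa.
  by have := cross i j iJ jJ ij; rewrite F0 -setI_eq0 set0I eqxx.
have [->|[i0 i0J]] := set_0Vmem J; first by rewrite cards0.
pose Jx x := [set i in J | x \in F i].
have sub : J \subset i0 |: \bigcup_(x in H i0) Jx x.
  apply/subsetP => i iJ; rewrite !inE; case: eqVneq => //= ii0.
  have /pred0Pn[x /andP[xF xH]] := cross i i0 iJ i0J ii0.
  by apply/bigcupP; exists x; rewrite // inE iJ.
have Jxle x : #|Jx x| <= (b + 1) ^ a.
  apply: (IH (fun i => F i :\ x)).
  - by move=> i; rewrite inE => /andP[iJ xF]; have := Fa i iJ; rewrite (cardsD1 x) xF.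
  - by move=> i; rewrite inE => /andP[iJ _]; apply: Hb.
  - move=> i; rewrite inE => /andP[iJ _]; apply: disjointWl (FH i iJ); exact: subD1set.
  - move=> i j; rewrite !inE => /andP[iJ xi] /andP[jJ xj] ij.
    have /pred0Pn[y /andP[yF yH]] := cross i j iJ jJ ij.
    apply/pred0Pn; exists y; rewrite /= in yF yH; rewrite /= !inE yF yH !andbT.
    by apply: contraTneq yH => ->; rewrite (disjointFr (FH j jJ) xj).
have := subset_leq_card sub; rewrite cardsU1 => /leq_trans; apply.
have -> : (b + 1) ^ a.+1 = (b + 1) ^ a + b * (b + 1) ^ a.
  by rewrite expnS mulnDl mul1n addnC.
apply: leq_add; first by rewrite (leq_trans (leq_b1 _)) // expn_gt0 addn1.
apply: (@leq_trans (\sum_(x in H i0) #|Jx x|)).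
  exact: card_bigcup_le.
apply: (@leq_trans (\sum_(x in H i0) (b + 1) ^ a)); first by apply: leq_sum.
by rewrite sum_nat_const leq_mul2r Hb ?orbT.
Qed.

Section Sparse.
Variables (V : finType) (part : V -> 'I_4) (G : {set {set V}}).
Hypothesis satG : saturated part G.
Variable K : nat.

Definition low : {set V} := [set v | #|nbh G v| <= K].

(** The families are the edges inside the neighbourhoods of the two ends: the ends
    of a matching edge share none, since G has no K4; nonadjacent ends of two
    matching edges share one, by saturation. *)
Lemma induced_matching_bound (i j : 'I_4) (M : {set V * V}) : i != j ->
    (forall p, p \in M -> [/\ part p.1 = i, part p.2 = j, adj G p.1 p.2,
      p.1 \in low & p.2 \in low]) ->
    (forall p q, p \in M -> q \in M -> p != q -> ~~ adj G p.1 q.2) ->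
  #|M| <= (K ^ 2 + 1) ^ (K ^ 2).
Proof.
move=> ij MP Mind; have [k [l up]] := two_other_parts ij.
pose F u := [set c : V * V | adj G c.1 c.2] :&: setX (nbh G u) (nbh G u).
have Fle u : u \in low -> #|F u| <= K ^ 2.
  rewrite inE => lu; apply: (leq_trans (subset_leq_card (subsetIr _ _))).
  by rewrite cardsX -mulnn leq_mul.
apply: (@cross_intersecting_bound _ _ (fun p => F p.1) (fun p => F p.2)).
- by move=> p /MP[_ _ _ l1 _]; apply: Fle.
- by move=> p /MP[_ _ _ _ l2]; apply: Fle.
- move=> p /MP[_ _ uv _ _]; apply/pred0P => -[c d] /=; apply/negP.
  rewrite !inE /= => /andP[/and3P[cd uc ud] /and3P[_ vc vd]].
  exact: (sat_free satG uv uc ud vc vd cd).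
- move=> p q pM qM pq; have [pi _ _ _ _] := MP p pM; have [_ qj _ _ _] := MP q qM.
  have [|c [d [_ _ uc ud [vc vd cd]]]] := @sat_fill _ _ _ satG p.1 q.2 k l _ (Mind p q pM qM pq).
    by rewrite pi qj.
  by apply/pred0Pn; exists (c, d); rewrite /= !inE /= cd uc ud vc vd.
Qed.

(** An edge between low vertices that avoids the neighbourhoods of all ends of a
    maximal induced matching could be added to the matching. *)
Lemma low_edge_cover (i j : 'I_4) : exists Z : {set V},
  #|Z| <= (K ^ 2 + 1) ^ (K ^ 2) * (2 * K) /\
  forall u v, part u = i -> part v = j -> u \in low -> v \in low -> adj G u v ->
    (u \in Z) || (v \in Z).
Proof.
have [->|ij] := eqVneq i j.
  exists set0; rewrite cards0; split=> // u v pu pv _ _ /(sat_part satG).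
  by rewrite pu pv eqxx.
pose P (M : {set V * V}) :=
  [forall p in M, [&& part p.1 == i, part p.2 == j, adj G p.1 p.2, p.1 \in low & p.2 \in low]] &&
  [forall p in M, forall q in M, (p != q) ==> ~~ adj G p.1 q.2].
have P0 : P set0 by apply/andP; split; apply/forall_inP => p; rewrite inE.
have [M /maxsetP[/andP[/forall_inP M1 /forall_inP M2] Mmax] _] := maxset_exists P0.
exists (\bigcup_(p in M) (nbh G p.1 :|: nbh G p.2)); split.
  apply: (@leq_trans (\sum_(p in M) #|nbh G p.1 :|: nbh G p.2|)).
    exact: card_bigcup_le.
  apply: (@leq_trans (\sum_(p in M) 2 * K)).
    apply: leq_sum => p /M1/and5P[_ _ _]; rewrite !inE => l1 l2.
    by rewrite cardsU (leq_trans (leq_subr _ _)) // mul2n -addnn leq_add.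
  rewrite sum_nat_const leq_mul2r; apply/orP; right.
  apply: (induced_matching_bound ij).
    by move=> p /M1/and5P[/eqP ? /eqP ? *].
  by move=> p q pM qM pq; have /forall_inP/(_ q qM) := M2 p pM; rewrite pq.
move=> u v pu pv lu lv uv; apply/negPn/negP; rewrite negb_or => /andP[nu nv].
have nM p : p \in M -> ~~ adj G u p.2 && ~~ adj G p.1 v.
  move=> pM; apply/andP; split.
    by apply: contra nu => h; apply/bigcupP; exists p; rewrite // !inE [adj G p.2 u]adjC h orbT.
  by apply: contra nv => h; apply/bigcupP; exists p; rewrite // !inE h.
have PM : P ((u, v) |: M).
  apply/andP; split; apply/forall_inP => p; rewrite !inE => /orP[/eqP ->|pM].
  - by rewrite /= pu pv !eqxx uv; move: lu lv; rewrite !inE => -> ->.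
  - by have := M1 p pM; rewrite !inE.
  - apply/forall_inP => q; rewrite !inE => /orP[/eqP ->|qM]; first by rewrite eqxx.
    by case/andP: (nM q qM) => /= -> _; rewrite implybT.
  - apply/forall_inP => q; rewrite !inE => /orP[/eqP ->|qM].
      by case/andP: (nM p pM) => _ /= ->; rewrite implybT.
    by have /forall_inP := M2 p pM; apply.
have /setP/(_ (u, v)) := Mmax _ PM (subsetUr _ _).
rewrite setU11 => /esym/nM /andP[]; by rewrite uv.
Qed.

Lemma low_independent : exists P : {set V}, [/\ P \subset low,
  forall u v, u \in P -> v \in P -> ~~ adj G u v &
  #|low| <= #|P| + 16 * ((K ^ 2 + 1) ^ (K ^ 2) * (2 * K))].
Proof.
have [Z ZP] := fin_all_exists (fun ij : 'I_4 * 'I_4 => low_edge_cover ij.1 ij.2).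
exists (low :\: \bigcup_ij Z ij); split; first exact: subsetDl.
  move=> u v; rewrite !in_setD => /andP[uZ lu] /andP[vZ lv]; apply/negP => uv.
  have [_ /(_ u v erefl erefl lu lv uv) /orP[]] := ZP (part u, part v) => h.
    by case/bigcupP: uZ; exists (part u, part v).
  by case/bigcupP: vZ; exists (part u, part v).
rewrite -leq_subLR; apply: (@leq_trans #|\bigcup_ij Z ij|).
  by rewrite cardsD subKn ?subset_leq_card ?subsetIl ?subsetIr.
apply: (@leq_trans (\sum_ij #|Z ij|)).
  exact: card_bigcup_le.
apply: (@leq_trans (\sum_(ij : 'I_4 * 'I_4) (K ^ 2 + 1) ^ (K ^ 2) * (2 * K))).
  by apply: leq_sum => ij _; have [] := ZP ij.
by rewrite sum_nat_const card_prod !card_ord.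
Qed.

End Sparse.

(** As K is at least 719, at most n / 20 vertices have degree above K, and apart
    from a constant number the other ones are independent.  A degree sum of at least 19 for the vertices of least
    degree in the four parts would give at least 19 * (19 / 20) n edges up to a
    constant, which exceeds 18 n. *)
Lemma exists_light_quad (K : nat) : 719 <= K -> exists N, forall n, N <= n ->
  forall (V : finType) (part : V -> 'I_4) (G : {set {set V}}),
    saturated part G -> (forall i, #|[set v | part v == i]| = n) -> #|G| <= 18 * n ->
  exists t1 t2 t3 t4, quad part G t1 t2 t3 t4 /\
    #|nbh G t1| + #|nbh G t2| + #|nbh G t3| + #|nbh G t4| <= 18.
Proof.
move=> K719; pose C := 16 * ((K ^ 2 + 1) ^ (K ^ 2) * (2 * K)).
exists (380 * C + 1) => n nN V part G satG card_part Gn.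
have [P [Plow Pind Pbig]] := low_independent satG K; rewrite -/C in Pbig.
have high : 20 * #|~: low G K| <= n.
  have : 720 * #|~: low G K| <= 36 * n; last by clear; lia.
  apply: (@leq_trans (\sum_u #|nbh G u|)); last first.
    by apply: leq_trans (sum_degrees_le satG) _; move: Gn; clear; lia.
  rewrite mulnC -sum_nat_const.
  rewrite [X in _ <= X](bigID (mem (~: low G K))) /= -[X in X <= _]addn0; apply: leq_add => //.
  apply: leq_sum => u; rewrite !inE -ltnNge => h; apply: leq_trans h.
  by rewrite ltnS.
pose Pi i := [set v in P | part v == i].
have Pisize i : 19 * n - 20 * C <= 20 * #|Pi i|.
  have : n <= #|Pi i| + #|~: P|.
    rewrite -(card_part i); apply: leq_trans (leq_card_setU _ _).
    by apply/subset_leq_card/subsetP => v; rewrite !inE => ->; case: (v \in P).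
  have := cardsC P; have := cardsC (low G K); move: high Pbig; clear.
  by move: #|~: low G K| #|low G K| #|P| #|~: P| #|V| #|Pi i| => *; lia.
have /fin_all_exists[t tP] i : exists u, u \in Pi i /\ forall v, v \in Pi i -> #|nbh G u| <= #|nbh G v|.
  have /card_gt0P[u0 u0P] : 0 < #|Pi i| by have := Pisize i; move: nN; clear; lia.
  by exists [arg min_(u < u0 in Pi i) #|nbh G u|]; case: arg_minnP.
have sumP : \sum_i #|Pi i| * #|nbh G (t i)| <= #|G|.
  apply: (@leq_trans (\sum_(u in P) #|nbh G u|)).
    rewrite (partition_big part xpredT) //=; apply: leq_sum => i _.
    rewrite -sum_nat_const big_mkcond /= [X in _ <= X]big_mkcond /=; apply: leq_sum => v _.
    rewrite [v \in Pi i]inE; case: ifP => // h; have [_ ] := tP i; apply.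
    by rewrite inE.
  rewrite big_mkcond /=.
  have h := @sum_outdeg_le _ G (fun u v => (u \in P) && adj G u v).
  apply: leq_trans (h _ _).
  - by apply: leq_sum => u _; case: ifP.
  - by move=> u v /andP[].
  - move=> u v /andP[uP uv]; rewrite negb_and adjC uv orbF.
    by apply/negP => vP; have := Pind u v uP vP; rewrite uv.
have tin i : t i \in P by have [] := tP i; rewrite inE => /andP[].
have tpart i : part (t i) = i by have [] := tP i; rewrite inE => /andP[_ /eqP].
pose o k := inord k : 'I_4.
exists (t (o 0)), (t (o 1)), (t (o 2)), (t (o 3)); split.
  by split; [rewrite !tpart; rewrite /= !inE -!val_eqE /= !inordK|do !split; apply: Pind].
have {sumP} : \sum_i (19 * n - 20 * C) * #|nbh G (t i)| <= 20 * #|G|.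
  rewrite (leq_trans _ (leq_mul (leqnn 20) sumP)) // big_distrr /=.
  by apply: leq_sum => i _; rewrite mulnA leq_mul2r Pisize orbT.
have oE : [/\ ord0 = o 0, lift ord0 ord0 = o 1, lift ord0 (lift ord0 ord0) = o 2 &
  lift ord0 (lift ord0 (lift ord0 ord0)) = o 3].
  by split; apply: val_inj; rewrite /= inordK.
have [o0 o1 o2 o3] := oE.
rewrite -big_distrr !big_ord_recl big_ord0 /= addn0 o3 o2 o1 o0 !addnA.
move: (_ + _ + _ + _) => D hD; rewrite leqNgt; apply/negP => D19.
have : (19 * n - 20 * C) * 19 <= 20 * (18 * n).
  by apply: leq_trans (leq_mul (leqnn 20) Gn); apply: leq_trans hD; rewrite leq_mul.
by move: nN; clear; lia.
Qed.

Lemma saturated_edges_ge : exists N, forall n, N <= n ->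
  forall (V : finType) (part : V -> 'I_4) (G : {set {set V}}),
    saturated part G -> (forall i, #|[set v | part v == i]| = n) ->
  18 * n <= #|G| + 21.
Proof.
have [N HN] := @exists_light_quad 719 (leqnn _).
exists N => n nN V part G satG card_part.
have [Gn|Gn] := leqP #|G| (18 * n); last by rewrite (leq_trans (ltnW Gn)) ?leq_addr.
have [t1 [t2 [t3 [t4 [Q D]]]]] := HN n nN V part G satG card_part Gn.
have [x [y [z [z' [w [w' B]]]]]] := quad_base satG Q D.
exact: (base_edges satG card_part B).
Qed.

(** * A saturated graph with 18 n - 21 edges *)

(** Vertex classes 3 i + j: in the part i, the classes j = 0 and j = 1 are single
    vertices and j = 2 is formed by all the others.  In terms of the core, 0 and 3
    are x and y, 6 and 7 are z and z', 9 and 10 are w and w'; 1 and 4 are the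
    additional neighbours of t2 and t1, and 2, 5, 8, 11 are the classes of
    t1, ..., t4.  The first fifteen pairs join special vertices; each other pair
    starts at one of the large classes. *)
Definition model_edges : seq (nat * nat) :=
  [:: (0, 3); (0, 6); (0, 10); (3, 7); (3, 9); (6, 9); (7, 10);
      (1, 3); (1, 9); (1, 7); (1, 10); (4, 0); (4, 6); (4, 10); (4, 7);
      (2, 3); (2, 6); (2, 7); (2, 9); (2, 4);
      (5, 0); (5, 6); (5, 9); (5, 10); (5, 1);
      (8, 0); (8, 3); (8, 9); (8, 10); (11, 0); (11, 3); (11, 6); (11, 7)].

Definition model a b := ((a, b) \in model_edges) || ((b, a) \in model_edges).

Lemma model_part a b : model a b -> a %/ 3 != b %/ 3.
Proof.
have /allP h : all (fun p => p.1 %/ 3 != p.2 %/ 3) model_edges by vm_compute.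
by case/orP=> /h //=; rewrite eq_sym.
Qed.

Lemma model_free a b c d : a < 12 -> b < 12 -> c < 12 -> d < 12 ->
  model a b -> model a c -> model a d -> model b c -> model b d -> model c d -> False.
Proof.
have h : all (fun a => all (fun b => if model a b then
    all (fun c => if model a c && model b c then
      all (fun d => ~~ [&& model a d, model b d & model c d]) (iota 0 12) else true)
    (iota 0 12) else true) (iota 0 12)) (iota 0 12) by vm_compute.
move=> a12 b12 c12 d12 ab ac ad bc bd cd.
have /allP/(_ b) := allP h a (etrans (mem_iota 0 12 a) a12).
rewrite mem_iota ab => /(_ b12) /allP/(_ c); rewrite mem_iota ac bc => /(_ c12) /allP/(_ d).
by rewrite mem_iota ad bd cd => /(_ d12).
Qed.

Lemma model_fill a b : a < 12 -> b < 12 -> a %/ 3 != b %/ 3 -> ~~ model a b ->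
  exists c d, [/\ c < 12, d < 12, model a c, model a d & [/\ model b c, model b d & model c d]].
Proof.
have h : all (fun a => all (fun b => [|| a %/ 3 == b %/ 3, model a b |
    has (fun c => if model a c && model b c then
      has (fun d => [&& model a d, model b d & model c d]) (iota 0 12) else false) (iota 0 12)])
    (iota 0 12)) (iota 0 12) by vm_compute.
move=> a12 b12 ab nab; have /allP/(_ b) := allP h a (etrans (mem_iota 0 12 a) a12).
rewrite mem_iota (negbTE ab) (negbTE nab) => /(_ b12) /hasP[c]; rewrite mem_iota => c12.
case: ifP => // /andP[ac bc] /hasP[d]; rewrite mem_iota => d12 /and3P[ad bd cd].
by exists c, d.
Qed.

Section Model.
Variable m : nat.
Let V := ('I_4 * 'I_m.+3)%type.

Definition code (v : V) := 3 * v.1 + minn v.2 2.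

Lemma code_lt v : code v < 12.
Proof. by rewrite /code; case: v => [[i i4] [j jm]] /=; lia. Qed.

Lemma code_part v : code v %/ 3 = v.1.
Proof. by rewrite /code; case: v => [[i i4] [j jm]] /=; lia. Qed.

(** The large classes are not empty because n is at least 3. *)
Lemma code_onto c : c < 12 -> exists v, code v = c.
Proof.
move=> c12; exists (inord (c %/ 3), inord (c %% 3)); rewrite /code /= !inordK; lia.
Qed.

Definition model_graph : {set {set V}} :=
  [set [set p.1; p.2] | p : V * V & (code p.1, code p.2) \in model_edges].

Lemma adj_model u v : adj model_graph u v = model (code u) (code v).
Proof.
apply/imsetP/orP => [[[a b]]|[uv|vu]]; first last.
- by exists (v, u); [rewrite inE|rewrite setUC].
- by exists (u, v); first rewrite inE.
rewrite inE /= => ab /setP E; have := model_part; move/(_ (code a) (code b)).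
rewrite /model ab => /(_ isT) ncode.
have nab : a != b by apply: contraNneq ncode => ->.
have Eu : u \in [set a; b] by rewrite -E !inE eqxx.
have Ev : v \in [set a; b] by rewrite -E !inE eqxx orbT.
have [Ea Eb] : a \in [set u; v] /\ b \in [set u; v] by rewrite !E !inE !eqxx orbT.
move: Ea Eb; case/set2P: Eu => ->; case/set2P: Ev => ->.
- by rewrite !inE !orbb (eq_sym b) (negbTE nab).
- by left.
- by right.
- by rewrite !inE !orbb (negbTE nab).
Qed.

Lemma model_saturated : K4_saturated (K4_blowup m.+3) model_graph.
Proof.
apply/K4_saturatedP; split.
  apply/subsetP => f /imsetP[[u v]]; rewrite inE /= => uv ->.
  rewrite K4_blowup_pair; have := @model_part (code u) (code v); rewrite /model uv !code_part.
  by move=> /(_ isT); apply: contra => /eqP ->.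
apply: saturated_intro => [u v|a b c d|u v uv].
- by rewrite adj_model => /model_part; rewrite !code_part; apply: contra => /eqP ->.
- by rewrite !adj_model; apply: model_free; apply: code_lt.
rewrite adj_model => /(model_fill (code_lt u) (code_lt v)).
rewrite !code_part => /(_ uv)[c [d [/code_onto[c' <-] /code_onto[d' <-] uc ud [vc vd cd]]]].
by exists c', d'; rewrite !adj_model.
Qed.

Lemma card_code c : #|[set v : V | code v == c]| <= if c %% 3 == 2 then m.+1 else 1.
Proof.
case: ifP => c3.
  apply: (@leq_trans #|[set (inord (c %/ 3) : 'I_4, rshift 2 j) | j : 'I_m.+1]|); last first.
    by rewrite (leq_trans (leq_imset_card _ _)) // card_ord.
  apply/subset_leq_card/subsetP => -[i j]; rewrite inE /code /= => /eqP e.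
  have j2 : 2 <= j by move: c3 e; clear; lia.
  have jm : j - 2 < m.+1 by have := ltn_ord j; move: j2; clear; lia.
  apply/imsetP; exists (Ordinal jm) => //; congr (_, _); apply: val_inj; rewrite /=.
    by rewrite inordK; have := ltn_ord i; move: e; clear; lia.
  by move: j2; clear; lia.
rewrite leqNgt; apply/negP => /card_gt1P[[i j] [[i' j']]].
rewrite !inE /code /= => -[/eqP e /eqP e' /eqP]; apply; congr (_, _); apply: val_inj => /=.
  by move: c3 e e'; clear; lia.
by move: c3 e e'; clear; lia.
Qed.

Lemma card_model_graph : #|model_graph| <= 18 * m.+3 - 21.
Proof.
apply: leq_trans (leq_imset_card _ _) _.
pose size_of c := if c %% 3 == 2 then m.+1 else 1.
apply: (@leq_trans (\sum_(e <- model_edges) size_of e.1 * size_of e.2)).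
  elim: model_edges => [|e s IH].
    rewrite big_nil leqn0 cards_eq0; apply/eqP/setP => p; rewrite !inE //.
  rewrite big_cons; apply: leq_trans (leq_add (leq_mul (card_code e.1) (card_code e.2)) IH).
  rewrite -cardsX; apply: leq_trans (leq_card_setU _ _).
  apply/subset_leq_card/subsetP => p; rewrite !inE => /orP[/eqP <-|->]; last by rewrite orbT.
  by rewrite !eqxx.
rewrite /model_edges !big_cons big_nil /size_of /=; lia.
Qed.
End Model.

Theorem theorem1 :
  exists n0 : nat, forall n : nat, n0 <= n ->
    sat_K4 (K4_blowup n) = 18 * n - 21.
Proof.
have [N lower] := saturated_edges_ge.
exists (N + 3) => n nN; rewrite /sat_K4; case: ex_minnP => k.
case/existsP=> G /andP[/K4_saturatedP[_ satG] /eqP <-] min; apply: anti_leq.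
apply/andP; split.
  move: #|G| min => g; move: nN {G satG lower}.
  case: n => [|[|[|m]]] nN; try by move: nN; clear; lia.
  move=> min; apply: leq_trans (card_model_graph m); apply: min.
  by apply/existsP; exists (model_graph m); rewrite model_saturated eqxx.
rewrite leq_subLR addnC; apply: lower satG _; first by rewrite (leq_trans _ nN) ?leq_addr.
move=> i; have -> : [set v : 'I_4 * 'I_n | v.1 == i] = [set (i, j) | j : 'I_n].
  apply/setP => -[i' j]; rewrite inE /=; apply/eqP/imsetP => [->|[j' _ [-> _]] //].
  by exists j.
by rewrite card_imset ?card_ord // => j j' [].
Qed.
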